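(* Let $n\ge1$ and $s,s_1,s_2\in(0,1)$ with $s_1+s_2=2s$. There exist $\alpha>0$ and a constant $C>0$ (independent of $K,z_1,z_2,h$) such that for every $K\in L^\infty(\mathbb{R}^n\times\mathbb{R}^n)$ and all $z_1\neq z_2$ in $\mathbb{R}^n$ the kernel $A_{K,s_1,s_2}$ (defined in the context) satisfies the size condition $$|A_{K,s_1,s_2}(z_1,z_2)|\le C\,\frac{\|K\|_{L^\infty(\mathbb{R}^n\times\mathbb{R}^n)}}{|z_1-z_2|^n}$$ and the regularity conditions $$\left|A_{K,s_1,s_2}(z_1+h,z_2)-A_{K,s_1,s_2}(z_1,z_2)\right|\le C\,\frac{|h|^\alpha\,\|K\|_{L^\infty(\mathbb{R}^n\times\mathbb{R}^n)}}{|z_1-z_2|^{n+\alpha}}\qquad\text{whenever }|h|\le\tfrac12|z_1-z_2|,$$ $$\left|A_{K,s_1,s_2}(z_1,z_2+h)-A_{K,s_1,s_2}(z_1,z_2)\right|\le C\,\frac{|h|^\alpha\,\|K\|_{L^\infty(\mathbb{R}^n\times\mathbb{R}^n)}}{|z_1-z_2|^{n+\alpha}}\qquad\text{whenever }|h|\le\tfrac12|z_1-z_2|.$$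
   Context: For $z_1\neq z_2$ in $\mathbb{R}^n$, $$A_{K,s_1,s_2}(z_1,z_2)=\int_{\mathbb{R}^n}\int_{\mathbb{R}^n}\frac{K(x,y)\left(|x-z_1|^{s_1-n}-|y-z_1|^{s_1-n}\right)\left(|x-z_2|^{s_2-n}-|y-z_2|^{s_2-n}\right)}{|x-y|^{n+2s}}\,dx\,dy.$$ *)

(* Defs.v *)
From HB Require Import structures.
From mathcomp Require Import all_boot all_order all_algebra.
From mathcomp Require Import all_classical all_reals all_analysis.

Set Implicit Arguments.
Unset Strict Implicit.
Unset Printing Implicit Defensive.
Import Order.TTheory GRing.Theory Num.Theory.
Import numFieldNormedType.Exports.
Local Open Scope classical_set_scope.
Local Open Scope ring_scope.

Definition measure_rV_display (d : measure_display) : measure_display.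
Proof. exact. Qed.

(* 'rV[T]_n carries the product sigma-algebra, generated by the coordinates;
   for T = R this is the Borel sigma-algebra of R^n. *)
Section measurable_rV.
Context {d} {T : measurableType d} (n : nat).

Let coor : 'I_n -> 'rV[T]_n -> T := fun i v => v ord0 i.

Let rV_set0 : g_sigma_preimage coor set0.
Proof. exact: sigma_algebra0. Qed.

Let rV_setC A : g_sigma_preimage coor A -> g_sigma_preimage coor (~` A).
Proof. exact: sigma_algebraC. Qed.

Let rV_bigcup (F : _^nat) : (forall i, g_sigma_preimage coor (F i)) ->
  g_sigma_preimage coor (\bigcup_i (F i)).
Proof. exact: sigma_algebra_bigcup. Qed.

HB.instance Definition _ := @isMeasurable.Build (measure_rV_display d)
  'rV[T]_n (g_sigma_preimage coor) rV_set0 rV_setC rV_bigcup.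

End measurable_rV.

Lemma measurable_coord d (T : measurableType d) n (i : 'I_n) :
  measurable_fun [set: 'rV[T]_n] (fun v => v ord0 i).
Proof.
move=> _ Y mY; rewrite setTI; apply: sub_sigma_algebra => /=.
rewrite -bigcup_seq/=; exists i => /=; first by rewrite mem_index_enum.
by exists Y => //; rewrite setTI.
Qed.

Lemma measurable_fun_rV d d' (S : measurableType d) (T : measurableType d') n
    (f : S -> 'rV[T]_n) :
  (forall i, measurable_fun [set: S] (fun x => f x ord0 i)) ->
  measurable_fun [set: S] f.
Proof.
move=> mf _ A mA; rewrite setTI; move: A mA.
rewrite -[X in forall A, X A -> _]/(g_sigma_preimage _) /=.
suff : g_sigma_preimage (fun (i : 'I_n) (v : 'rV[T]_n) => v ord0 i)
    `<=` [set A | d.-measurable (f @^-1` A)] by [].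
apply: smallest_sub.
  split=> /=.
  - by rewrite preimage_set0.
  - by move=> A mA; rewrite setTD preimage_setC; exact: measurableC.
  - by move=> F mF; rewrite preimage_bigcup; exact: bigcupT_measurable.
rewrite -bigcup_seq/=; apply: bigcup_sub => i _ _ [B mB <-] /=.
by rewrite setTI -comp_preimage -[X in measurable X]setTI; exact: mf.
Qed.

Lemma measurable_rV_box d (T : measurableType d) n (A : 'I_n -> set T) :
  (forall i, measurable (A i)) ->
  measurable [set v : 'rV[T]_n | forall i, A i (v ord0 i)].
Proof.
move=> mA.
rewrite [X in measurable X](_ : _ =
    \bigcap_(i in [set: 'I_n]) (fun v : 'rV[T]_n => v ord0 i) @^-1` A i).
  apply: fin_bigcap_measurable => // i _.
  by rewrite -[X in measurable X]setTI; exact: measurable_coord.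
by apply/seteqP; split => [v Av i _|v Av i]; exact: Av.
Qed.

Section lebesgue_measure_rV.
Context {R : realType}.

Definition rV_cons n (p : R * 'rV[R]_n) : 'rV[R]_n.+1 :=
  row_mx (p.1)%:M p.2 : 'rV_(1 + n).

Definition rV_uncons n (v : 'rV[R]_n.+1) : R * 'rV[R]_n :=
  (v ord0 ord0, \row_j v ord0 (lift ord0 j)).

Lemma rV_cons0 n (p : R * 'rV[R]_n) : rV_cons p ord0 ord0 = p.1.
Proof.
have -> : @ord0 n = lshift n (@ord0 0) by exact: val_inj.
by apply: etrans (row_mxEl _ _ _ _) _; rewrite mxE.
Qed.

Lemma rV_consS n (p : R * 'rV[R]_n) j :
  rV_cons p ord0 (lift ord0 j) = p.2 ord0 j.
Proof.
have -> : lift ord0 j = rshift 1 j by exact: val_inj.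
exact: row_mxEr.
Qed.

Lemma rV_consK n : cancel (@rV_cons n) (@rV_uncons n).
Proof.
move=> p; rewrite /rV_uncons rV_cons0 [RHS]surjective_pairing; congr pair.
by apply/rowP => j; rewrite mxE rV_consS.
Qed.

Lemma measurable_rV_cons n : measurable_fun [set: R * 'rV[R]_n] (@rV_cons n).
Proof.
apply: measurable_fun_rV => i; case: (unliftP ord0 i) => [j|] ->.
  rewrite [X in measurable_fun _ X](_ : _ =
      (fun v : 'rV[R]_n => v ord0 j) \o snd); last first.
    by apply/funext => p /=; rewrite rV_consS.
  exact: (measurableT_comp (measurable_coord j)).
rewrite [X in measurable_fun _ X](_ : _ = fst); first exact: measurable_fst.
by apply/funext => p /=; rewrite rV_cons0.
Qed.

Lemma measurable_rV_uncons n :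
  measurable_fun [set: 'rV[R]_n.+1] (@rV_uncons n).
Proof.
apply: measurable_fun_pair; first exact: measurable_coord.
apply: measurable_fun_rV => j; under eq_fun do rewrite mxE.
exact: measurable_coord.
Qed.

Section succ.
Variables (n : nat) (mu : {sigma_finite_measure set 'rV[R]_n -> \bar R}).

Definition lebesgue_measure_rVS : set 'rV[R]_n.+1 -> \bar R :=
  pushforward (@lebesgue_measure R \x mu)%E (@rV_cons n).

Let m0 : lebesgue_measure_rVS set0 = 0%E.
Proof. by rewrite /lebesgue_measure_rVS /pushforward preimage_set0 measure0. Qed.

Let m_ge0 A : (0 <= lebesgue_measure_rVS A)%E.
Proof. exact: (measure_ge0 (@lebesgue_measure R \x mu)%E). Qed.

Let m_sigma_additive : semi_sigma_additive lebesgue_measure_rVS.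
Proof.
exact: (@measure_semi_sigma_additive _ _ _
  (measure_function_pushforward__canonical__measure_function_Measure
    (@lebesgue_measure R \x mu)%E (@measurable_rV_cons n))).
Qed.

HB.instance Definition _ := isMeasure.Build _ _ _ lebesgue_measure_rVS
  m0 m_ge0 m_sigma_additive.

Let m_sigma_finite : sigma_finite setT lebesgue_measure_rVS.
Proof.
have /sigma_finiteP[F [TF ndF Foo]] := sigma_finiteT (@lebesgue_measure R).
have /sigma_finiteP[G [TG ndG Goo]] := sigma_finiteT mu.
exists (fun k => @rV_uncons n @^-1` (F k `*` G k)).
  rewrite -preimage_bigcup [X in _ @^-1` X](_ : _ = setT) ?preimage_setT//.
  rewrite -setXTT TF TG predeqE => -[x y]; split.
    by move=> [k _ []/= ? ?]; split; exists k.
  move=> [/= [k _ Fkx] [l _ Gly]]; exists (maxn k l) => //; split.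
  - by move: x Fkx; exact/subsetPset/ndF/leq_maxl.
  - by move: y Gly; exact/subsetPset/ndG/leq_maxr.
move=> k; have [mF Fkoo] := Foo k; have [mG Gkoo] := Goo k; split.
  by rewrite -[X in measurable X]setTI; apply: measurable_rV_uncons => //;
    exact: measurableX.
rewrite /lebesgue_measure_rVS /pushforward -comp_preimage.
rewrite (_ : _ \o _ = id) ?preimage_id; last first.
  by apply/funext => p /=; rewrite rV_consK.
by rewrite product_measure1E// lte_mul_pinfty// ge0_fin_numE.
Qed.

HB.instance Definition _ := @Measure_isSigmaFinite.Build _ _ _
  lebesgue_measure_rVS m_sigma_finite.

End succ.

(* The n-fold product of the one-dimensional Lebesgue measure; it is
   characterized by its values on boxes, see lebesgue_measure_rV_box. *)
Fixpoint lebesgue_measure_rV n : {sigma_finite_measure set 'rV[R]_n -> \bar R} :=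
  match n with
  | 0 => \d_(0 : 'rV[R]_0)
  | n'.+1 => lebesgue_measure_rVS (lebesgue_measure_rV n')
  end.

Lemma lebesgue_measure_rV_box n (A : 'I_n -> set R) :
  (forall i, measurable (A i)) ->
  lebesgue_measure_rV n [set v | forall i, A i (v ord0 i)] =
    (\prod_(i < n) lebesgue_measure (A i))%E.
Proof.
elim: n A => [|n IHn] A mA.
  rewrite big_ord0 /= diracE [X in _ \in X](_ : _ = setT) ?in_setT//.
  by apply/seteqP; split => // v _ [].
rewrite big_ord_recl -IHn//= /lebesgue_measure_rVS /pushforward.
rewrite (_ : _ @^-1` _ =
    A ord0 `*` [set v : 'rV[R]_n | forall i, A (lift ord0 i) (v ord0 i)]).
  rewrite product_measure1E//; first exact: mA.
  exact: measurable_rV_box (fun i => mA (lift ord0 i)).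
apply/seteqP; split => [p /= Ap|p /= [A0 AS] i].
  split => [|i]; first by rewrite -[p.1]rV_cons0.
  by rewrite -rV_consS.
by case: (unliftP ord0 i) => [j|] ->; rewrite ?rV_consS ?rV_cons0.
Qed.

End lebesgue_measure_rV.

Section kernel.
Context {R : realType} (n : nat).

(* The norm `|v| that the library puts on 'rV[R]_n is the sup norm. *)
Definition enorm (v : 'rV[R]_n) : R := Num.sqrt (\sum_(i < n) v ord0 i ^+ 2).

(* The value lies in \bar R: an integral that diverges, or of the form oo - oo,
   is infinite by the library's conventions, so a finite bound on kernelA
   includes the convergence of the outer integral. Where the formula is singular
   (x or y equal to z1 or z2, or x = y) the integrand takes some finite value;
   for n >= 1 these points are negligible. *)
Definition kernelA (s s1 s2 : R) (K : 'rV[R]_n * 'rV[R]_n -> R)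
    (z1 z2 : 'rV[R]_n) : \bar R :=
  (\int[lebesgue_measure_rV n]_y \int[lebesgue_measure_rV n]_x
    (K (x, y)
      * (enorm (x - z1) `^ (s1 - n%:R) - enorm (y - z1) `^ (s1 - n%:R))
      * (enorm (x - z2) `^ (s2 - n%:R) - enorm (y - z2) `^ (s2 - n%:R))
      / enorm (x - y) `^ (n%:R + 2 * s))%:E)%E.

End kernel.

(* Main.v *)
Require Import Defs.
From mathcomp Require Import all_boot all_order all_algebra.
From mathcomp Require Import all_classical all_reals all_analysis.
From mathcomp Require Import measurable_realfun ess_sup_inf ring lra.
Import Order.TTheory GRing.Theory Num.Theory.
Import numFieldNormedType.Exports.
Local Open Scope classical_set_scope.
Local Open Scope ring_scope.

(** Put a_i = n - s_i, rho = |x - y|, and let m_i and M_i be the minimum and the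
    maximum of |x - z_i| and |y - z_i|. For 0 <= t <= 1,
      | |x - z_i|^-a_i - |y - z_i|^-a_i | <= n (rho / M_i)^t m_i^-a_i,
    and replacing z_1 by z_1 + h changes the left-hand side for i = 1 by at most
    a constant times |h|^alpha (rho / M_1)^(1 - alpha) m_1^-(a_1 + alpha), summed
    over the two centres. Hence size and regularity both follow from a bound
    C d^-(n + B_1 + B_2), d = |z_1 - z_2|, on the double integral of
      rho^-(n + s_1 + s_2) (rho / M_1)^t_1 (rho / M_2)^t_2 m_1^-b_1 m_2^-b_2
    with t_i slightly above s_i and b_i = a_i + B_i.
    By symmetry let |x - z_1| be the smallest of the four distances. Either m_2 is
    comparable to |x - z_2|, and one integrates over y around x, then over x
    around z_1; or |y - z_2| < rho, so that rho dominates max(d, |y - z_2|), and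
    one integrates over x around z_1, then over y around z_2. All these integrals
    are radial and bounded by a dyadic decomposition. *)

(** * Inequalities for real powers and their differences *)

Section real_lemmas.
Context {R : realType}.
Implicit Types x y u v a p t : R.

Lemma gt0_powRE x p : 0 < x -> x `^ p = expR (p * ln x).
Proof. by move=> x0; rewrite /powR gt_eqF. Qed.

Lemma powRN_le (k x y p : R) : 0 < y -> 0 < k -> 0 <= p -> y <= k * x ->
  x `^ (- p) <= k `^ p * y `^ (- p).
Proof.
move=> y0 k0 p0 yx; have x0 : 0 < x by rewrite -(pmulr_rgt0 _ k0) (lt_le_trans y0).
rewrite !powRN ler_pdivlMr ?powR_gt0// mulrC ler_pdivrMr ?powR_gt0//.
rewrite -powRM ?(ltW k0) ?(ltW x0)//.
by apply: ge0_ler_powR => //; rewrite nnegrE ?mulr_ge0 ?ltW.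
Qed.

Lemma powRN_anti x y p : 0 < y -> 0 <= p -> y <= x -> x `^ (- p) <= y `^ (- p).
Proof.
by move=> y0 p0 yx; have := @powRN_le 1 x y p y0 ltr01 p0; rewrite mul1r powR1 mul1r; apply.
Qed.

(** Induction through 1 - t^(m+1) = t (1 - t^m) + (1 - t), where the factor t <= 1 is dropped. *)
Lemma one_sub_exprn_le t m : 0 <= t <= 1 -> 1 - t ^+ m <= m%:R * (1 - t).
Proof.
move=> /andP[t0 t1]; elim: m => [|m IH]; first by rewrite expr0 subrr mul0r.
rewrite exprS -natr1 mulrDl mul1r.
have -> : 1 - t * t ^+ m = t * (1 - t ^+ m) + (1 - t) by ring.
rewrite lerD2r (le_trans _ IH)// ler_piMl// subr_ge0 exprn_ile1//.
Qed.

(** With t = u / v the left-hand side is u^-a (1 - t^a). Since t <= 1 and a <= n, 1 - t^a <= 1 - t^n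
    <= n (1 - t), and 1 - t <= (1 - t)^th because 1 - t lies in [0, 1]. *)
Lemma powRN_sub_le n u v a th : 0 < u -> u <= v -> 0 <= a -> a <= n%:R ->
  0 <= th <= 1 ->
  u `^ (- a) - v `^ (- a) <= n%:R * ((v - u) / v) `^ th * u `^ (- a).
Proof.
move=> u0 uv a0 an /andP[th0 th1]; have v0 := lt_le_trans u0 uv.
pose t := u / v.
have t0 : 0 < t by rewrite divr_gt0.
have t1 : t <= 1 by rewrite ler_pdivrMr// mul1r.
have -> : v `^ (- a) = u `^ (- a) * t `^ a.
  rewrite !gt0_powRE// lnM ?posrE ?invr_gt0// lnV ?posrE// -expRD; congr expR; ring.
have -> : (v - u) / v = 1 - t by rewrite mulrBl divff ?gt_eqF.
rewrite -{1}[u `^ (- a)]mulr1 -mulrBr mulrC ler_wpM2r ?powR_ge0//.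
have h1 : 1 - t `^ a <= 1 - t ^+ n.
  by rewrite lerD2l lerN2 -powR_mulrn ?(ltW t0)// ger_powR// t0 t1.
rewrite (le_trans h1)//; apply: le_trans.
  by apply: one_sub_exprn_le; rewrite (ltW t0) t1.
rewrite ler_wpM2l//.
have [->|tneq] := eqVneq t 1; first by rewrite subrr powR_ge0.
by apply: ger1_powR => //; rewrite subr_gt0 lt_neqAle tneq t1 lerBlDr lerDl ltW.
Qed.

Lemma dist_powRN_le n (u v rho a th : R) : 0 < u -> 0 < v -> `|u - v| <= rho ->
  0 <= a -> a <= n%:R -> 0 <= th <= 1 ->
  `|u `^ (- a) - v `^ (- a)| <=
    n%:R * (rho / Num.max u v) `^ th * (Num.min u v) `^ (- a).
Proof.
move=> + + + a0 an th01; wlog uv : u v / u <= v => [H u0 v0 uvr|u0 v0 uvr].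
  have /orP[uv|vu] := le_total u v; first exact: H.
  by rewrite distrC maxC minC; apply: H => //; rewrite distrC.
rewrite (max_idPr uv) (min_idPl uv) ger0_norm; last first.
  by rewrite subr_ge0 powRN_anti.
apply: le_trans (powRN_sub_le n u v a th u0 uv a0 an th01) _.
rewrite ler_wpM2r ?powR_ge0// ler_wpM2l// ge0_ler_powR//.
- by case/andP: th01.
- by rewrite nnegrE divr_ge0 ?subr_ge0// ltW.
- by rewrite nnegrE divr_ge0 ?(ltW v0)// (le_trans _ uvr).
- by rewrite ler_pM2r ?invr_gt0// (le_trans _ uvr)// distrC ler_norm.
Qed.

(** Split the minimum m as m^al m^(1 - al) and bound one factor through x, the other through y. This
    interpolates between the two estimates in [dist2_powRN_le]. *)
Lemma min_le_powR x y al : 0 <= x -> 0 <= y -> 0 <= al <= 1 ->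
  Num.min x y <= x `^ al * y `^ (1 - al).
Proof.
move=> x0 y0 /andP[al0 al1].
set m := Num.min x y; have m0 : 0 <= m by rewrite le_min x0 y0.
have [->|mn0] := eqVneq m 0; first by rewrite mulr_ge0 ?powR_ge0.
have -> : m = m `^ al * m `^ (1 - al).
  by rewrite -powRD ?mn0 ?implybT// addrC subrK powRr1.
by rewrite ler_pM ?powR_ge0// ge0_ler_powR ?nnegrE ?subr_ge0// ge_min lexx ?orbT.
Qed.

(* The second difference is bounded by [h/m] and by [rho/M], hence by a geometric mean of both. *)
Lemma dist2_powRN_le n (u u' v v' h rho a al : R) : 0 < u -> 0 < u' -> 0 < v -> 0 < v' ->
  `|u - u'| <= h -> `|v - v'| <= h -> `|u - v| <= rho -> `|u' - v'| <= rho ->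
  rho <= u + v -> rho <= u' + v' ->
  0 <= a -> a <= n%:R -> 0 <= al <= 1 ->
  `|(u' `^ (- a) - v' `^ (- a)) - (u `^ (- a) - v `^ (- a))| <=
    4 * n%:R * h `^ al *
     ((rho / Num.max u v) `^ (1 - al) * (Num.min u v) `^ (- (a + al))
    + (rho / Num.max u' v') `^ (1 - al) * (Num.min u' v') `^ (- (a + al))).
Proof.
move=> + + + + + + + + + + a0 an al01.
(* The bound is symmetric under exchange of the primed and unprimed pairs, so m may be taken to be
   the smaller minimum. *)
wlog mm : u u' v v' / Num.min u v <= Num.min u' v'.
  move=> H u0 u'0 v0 v'0 uh vh uv uv' r r'.
  have /orP[mm|mm] := le_total (Num.min u v) (Num.min u' v'); first exact: H.
  rewrite distrC [X in _ * X]addrC; apply: H => //; by rewrite distrC.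
move=> u0 u'0 v0 v'0 uh vh uv uv' r r'.
set m := Num.min u v in mm *; set M := Num.max u v.
set m' := Num.min u' v' in mm *; set M' := Num.max u' v'.
have m0 : 0 < m by rewrite lt_min u0.
have M0 : 0 < M by rewrite lt_max u0.
have M'0 : 0 < M' by rewrite lt_max u'0.
have h0 : 0 <= h := le_trans (normr_ge0 _) uh.
have rho0 : 0 <= rho := le_trans (normr_ge0 _) uv.
have mM' : m <= M'.
  by rewrite (le_trans mm)// le_max ge_min lexx.
(* M <= m + rho, rho <= u' + v' <= 2 M' and m <= M'. Hence both first differences are controlled by
   rho / M and m, with total constant 1 + 3 = 4. *)
have MM' : M <= 3 * M'.
  have : M <= m + rho.
    rewrite /M /m; move: uv; rewrite ler_norml => /andP[? ?].
    by case: (leP u v) => uv_; lra.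
  have : rho <= M' + M' by rewrite (le_trans r')// lerD// le_max lexx ?orbT.
  by move: mM'; lra.
have n0 : 0 <= n%:R :> R by [].
have one01 : (0 : R) <= (1 : R) <= (1 : R) by apply/andP; split; rewrite ?ler01.
have ma0 : 0 <= m `^ (- a) := powR_ge0 _ _.
have HB : `|(u' `^ (- a) - v' `^ (- a)) - (u `^ (- a) - v `^ (- a))| <=
    4 * n%:R * (rho / M) * m `^ (- a).
  apply: le_trans (ler_normB _ _) _.
  have := @dist_powRN_le n _ _ _ a 1 u0 v0 uv a0 an one01.
  have := @dist_powRN_le n _ _ _ a 1 u'0 v'0 uv' a0 an one01.
  rewrite -/M -/m -/M' -/m' !powRr1 ?divr_ge0 ?(ltW M0) ?(ltW M'0)// => h1 h2.
  have : n%:R * (rho / M') * m' `^ (- a) <= n%:R * (3 * (rho / M)) * m `^ (- a).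
    rewrite ler_pM ?mulr_ge0 ?powR_ge0 ?invr_ge0 ?(ltW M'0)//.
      rewrite ler_wpM2l// mulrCA ler_wpM2l// ler_pdivlMr// mulrC.
      by rewrite ler_pdivrMr.
    exact: powRN_anti.
  by move: h1 h2; nra.
(* Here u is paired with u' and v with v': each difference has arguments at least m that are at most
   h apart. *)
have HA : `|(u' `^ (- a) - v' `^ (- a)) - (u `^ (- a) - v `^ (- a))| <=
    4 * n%:R * (h / m) * m `^ (- a).
  have -> : (u' `^ (- a) - v' `^ (- a)) - (u `^ (- a) - v `^ (- a)) =
     (u' `^ (- a) - u `^ (- a)) - (v' `^ (- a) - v `^ (- a)) by ring.
  apply: le_trans (ler_normB _ _) _.
  have P z z' : 0 < z -> 0 < z' -> m <= z -> m <= z' -> `|z - z'| <= h ->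
      `|z' `^ (- a) - z `^ (- a)| <= n%:R * (h / m) * m `^ (- a).
    move=> z0 z'0 mz mz' zh; rewrite distrC.
    apply: le_trans (@dist_powRN_le n _ _ _ a 1 z0 z'0 zh a0 an one01) _.
    have zz0 : 0 < Num.max z z' by rewrite lt_max z0.
    rewrite powRr1 ?divr_ge0 ?(ltW zz0)// ler_pM ?mulr_ge0 ?powR_ge0 ?invr_ge0 ?(ltW zz0)//.
      by rewrite ler_wpM2l// ler_wpM2l// lef_pV2 ?posrE// le_max mz.
    by apply: powRN_anti => //; rewrite le_min mz.
  have h1 := P u u' u0 u'0; have h2 := P v v' v0 v'0.
  have h3 : 0 <= n%:R * (h / m) * m `^ (- a).
    by rewrite !mulr_ge0 ?powR_ge0 ?invr_ge0 ?(ltW m0).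
  have /h1{}h1 : m <= u by rewrite ge_min lexx.
  have /h2{}h2 : m <= v by rewrite ge_min lexx orbT.
  have /h1{}h1 : m <= u' by rewrite (le_trans mm)// ge_min lexx.
  have /h2{}h2 : m <= v' by rewrite (le_trans mm)// ge_min lexx orbT.
  move/(_ uh) : h1 => h1; move/(_ vh) : h2 => h2.
  by move: h1 h2 h3; lra.
apply: (@le_trans _ _ (4 * n%:R * (Num.min (h / m) (rho / M)) * m `^ (- a))).
  by case: (leP (h / m)) => _.
apply: (@le_trans _ _ (4 * n%:R * h `^ al * ((rho / M) `^ (1 - al) * m `^ (- (a + al))))); last first.
  by rewrite ler_wpM2l ?lerDl ?mulr_ge0 ?powR_ge0.
have := min_le_powR (h / m) (rho / M) al (divr_ge0 h0 (ltW m0)) (divr_ge0 rho0 (ltW M0)) al01.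
rewrite powRM ?invr_ge0 ?(ltW m0)// => Hm.
have -> : m `^ (- (a + al)) = m^-1 `^ al * m `^ (- a).
  rewrite !gt0_powRE ?invr_gt0// lnV ?posrE// -expRD; congr expR; ring.
have -> : 4 * n%:R * h `^ al * ((rho / M) `^ (1 - al) * (m^-1 `^ al * m `^ (- a))) =
  4 * n%:R * (h `^ al * m^-1 `^ al * (rho / M) `^ (1 - al)) * m `^ (- a) by ring.
by rewrite ler_wpM2r// ler_wpM2l// mulr_ge0.
Qed.

End real_lemmas.

(** * Pointwise domination of the kernel by iterated radial functions *)

Section pointwise.
Context {R : realType}.

(* [u1, v1, u2, v2] stand for |x - w1|, |y - w1|, |x - w2|, |y - w2|, and [rho] for |x - y|. *)
Definition hker (c t1 t2 b1 b2 rho u1 v1 u2 v2 : R) : R :=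
  rho `^ (- c) * (rho / Num.max u1 v1) `^ t1 * (rho / Num.max u2 v2) `^ t2 *
  Num.min u1 v1 `^ (- b1) * Num.min u2 v2 `^ (- b2).

(* Integrated over a point at distance [rho] from a centre and then over one at distance [r]
   from another centre, this is radial both times; [d] is the distance of the singularities. *)
Definition pker (p1 q1 p2 q2 d r rho : R) : R :=
  r `^ (- p1) * Num.max d r `^ (- q1) * (rho `^ (- p2) * Num.max r rho `^ (- q2)).

Lemma hkerC12 (c t1 t2 b1 b2 rho u1 v1 u2 v2 : R) :
  hker c t1 t2 b1 b2 rho u1 v1 u2 v2 = hker c t2 t1 b2 b1 rho u2 v2 u1 v1.
Proof. by rewrite /hker; ring. Qed.

Lemma hkerCxy (c t1 t2 b1 b2 rho u1 v1 u2 v2 : R) :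
  hker c t1 t2 b1 b2 rho u1 v1 u2 v2 = hker c t1 t2 b1 b2 rho v1 u1 v2 u2.
Proof. by rewrite /hker (maxC u1) (maxC u2) (minC u1) (minC u2). Qed.

Lemma hker_ge0 (c t1 t2 b1 b2 rho u1 v1 u2 v2 : R) :
  0 <= hker c t1 t2 b1 b2 rho u1 v1 u2 v2.
Proof. by rewrite !mulr_ge0 ?powR_ge0. Qed.

Lemma pker_ge0 (p1 q1 p2 q2 d r rho : R) : 0 <= pker p1 q1 p2 q2 d r rho.
Proof. by rewrite !mulr_ge0 ?powR_ge0. Qed.

Lemma ratio_powR_le (k rho M N t : R) : 0 < k -> 0 < rho -> 0 < N -> 0 <= t ->
  N <= k * M -> (rho / M) `^ t <= k `^ t * (rho / N) `^ t.
Proof.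
move=> k0 r0 N0 t0 NM; have M0 : 0 < M by rewrite -(pmulr_rgt0 _ k0) (lt_le_trans N0).
rewrite -powRM ?(ltW k0) ?divr_ge0 ?(ltW N0) ?(ltW r0)//.
apply: ge0_ler_powR => //.
- by rewrite nnegrE divr_ge0 ?(ltW M0) ?(ltW r0).
- by rewrite nnegrE mulr_ge0 ?divr_ge0 ?(ltW N0) ?(ltW r0) ?(ltW k0).
- by rewrite mulrCA ler_wpM2l ?(ltW r0)// ler_pdivlMr// mulrC ler_pdivrMr.
Qed.

(** Here u1 is the smallest of the four distances. The first summand bounds the kernel when min(u2,
    v2) controls max(d, u1), the second otherwise. In the second case u1 <= v2, so max(v2, u1) = v2
    and the exponent e is free: it turns a power of v2 into a factor that later gives the integral
    over the point near w1 its decay at infinity. *)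
Lemma hker_le (c t1 t2 b1 b2 e d rho u1 v1 u2 v2 : R) :
  0 <= c -> 0 <= t1 -> 0 <= t2 -> 0 <= b1 -> 0 <= b2 ->
  0 < u1 -> 0 < v1 -> 0 < u2 -> 0 < v2 -> 0 < rho -> 0 < d ->
  rho <= u1 + v1 -> rho <= u2 + v2 -> u2 <= v2 + rho -> v1 <= u1 + rho ->
  d <= u1 + u2 -> d <= v1 + v2 ->
  u1 <= v1 -> u1 <= u2 -> u1 <= v2 ->
  hker c t1 t2 b1 b2 rho u1 v1 u2 v2 <=
   (2 `^ t1 * 2 `^ t2 * (4 `^ b2 + 3 `^ c)) *
   (pker b1 (b2 + t2) (c - t1 - t2) t1 d u1 rho + pker (b2 - e) c b1 e d v2 u1).
Proof.
move=> c0 t10 t20 b10 b20 u10 v10 u20 v20 r0 d0 ruv1 ruv2 uvr2 vur1 du dv u1v1 u1u2 u1v2.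
set T := pker _ _ _ _ _ _ _; set V := pker _ _ _ _ _ _ _.
have T0 : 0 <= T := pker_ge0 _ _ _ _ _ _ _.
have V0 : 0 <= V := pker_ge0 _ _ _ _ _ _ _.
have two0 : 0 < 2 :> R by [].
have [/orP case1|/norP[]] := boolP ((rho <= v2) || (u2 <= v2)).
  suff H : hker c t1 t2 b1 b2 rho u1 v1 u2 v2 <= 2 `^ t1 * 2 `^ t2 * 4 `^ b2 * T.
    apply: (le_trans H).
    by rewrite -!mulrA !ler_wpM2l ?powR_ge0// ler_pM ?powR_ge0// lerDl ?powR_ge0.
  have ur0 : 0 < Num.max u1 rho by rewrite lt_max u10.
  have du0 : 0 < Num.max d u1 by rewrite lt_max u10 orbT.
  have M1 : Num.max u1 rho <= 2 * Num.max u1 v1.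
    have : v1 <= Num.max u1 v1 by rewrite le_max lexx orbT.
    by rewrite ge_max => ?; apply/andP; split; lra.
  (* d <= u1 + u2 <= 2 u2, and u2 is either the minimum itself or at most v2 + rho <= 2 v2. *)
  have m2 : Num.max d u1 <= 4 * Num.min u2 v2.
    by rewrite ge_max; case: (leP u2 v2) => h; apply/andP; split; case: case1 => ?; lra.
  have M2 : Num.max d u1 <= 2 * Num.max u2 v2.
    have : u2 <= Num.max u2 v2 by rewrite le_max lexx.
    by rewrite ge_max => ?; apply/andP; split; lra.
  have h1 := ratio_powR_le 2 rho _ _ t1 two0 r0 ur0 t10 M1.
  have h2 := ratio_powR_le 2 rho _ _ t2 two0 r0 du0 t20 M2.
  have h3 := powRN_le 4 _ _ b2 du0 ltac:(by []) b20 m2.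
  have -> : 2 `^ t1 * 2 `^ t2 * 4 `^ b2 * T = rho `^ (- c) *
     (2 `^ t1 * (rho / Num.max u1 rho) `^ t1) * (2 `^ t2 * (rho / Num.max d u1) `^ t2) *
     u1 `^ (- b1) * (4 `^ b2 * Num.max d u1 `^ (- b2)).
    rewrite /T /pker; set M := Num.max d u1; set N := Num.max u1 rho.
    rewrite -/M in du0; rewrite -/N in ur0.
    rewrite !gt0_powRE ?divr_gt0// !lnM ?posrE ?invr_gt0// !lnV ?posrE//.
    by rewrite -!expRD; congr expR; ring.
  rewrite /hker [Num.min u1 v1](min_idPl u1v1).
  by rewrite !ler_pM ?mulr_ge0 ?powR_ge0.
rewrite -!ltNge => v2r v2u2.
suff H : hker c t1 t2 b1 b2 rho u1 v1 u2 v2 <= 2 `^ t1 * 2 `^ t2 * 3 `^ c * V.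
  apply: (le_trans H).
  by rewrite -!mulrA !ler_wpM2l ?powR_ge0// ler_pM ?powR_ge0// lerDr ?powR_ge0.
have dv0 : 0 < Num.max d v2 by rewrite lt_max d0.
(* Now v2 < rho, and d <= v1 + v2 <= u1 + rho + v2 with u1 <= v2. *)
have R3 : Num.max d v2 <= 3 * rho by rewrite ge_max; apply/andP; split; lra.
have M1 : rho <= 2 * Num.max u1 v1.
  have : v1 <= Num.max u1 v1 by rewrite le_max lexx ?orbT.
  by move=> ?; lra.
have M2 : rho <= 2 * Num.max u2 v2.
  have : u2 <= Num.max u2 v2 by rewrite le_max lexx ?orbT.
  by move=> ?; lra.
have h1 := ratio_powR_le 2 rho _ _ t1 two0 r0 r0 t10 M1.
have h2 := ratio_powR_le 2 rho _ _ t2 two0 r0 r0 t20 M2.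
have h3 := powRN_le 3 _ _ c dv0 ltac:(by []) c0 R3.
have -> : 2 `^ t1 * 2 `^ t2 * 3 `^ c * V = (3 `^ c * Num.max d v2 `^ (- c)) *
   (2 `^ t1 * (rho / rho) `^ t1) * (2 `^ t2 * (rho / rho) `^ t2) *
   u1 `^ (- b1) * v2 `^ (- b2).
  rewrite /V /pker; set M := Num.max d v2; rewrite -/M in dv0.
  rewrite (max_idPl u1v2) divff ?gt_eqF// !powR1 !mulr1.
  rewrite !gt0_powRE//.
  by rewrite -!expRD; congr expR; ring.
rewrite /hker [Num.min u1 v1](min_idPl u1v1) [Num.min u2 v2](min_idPr (ltW v2u2)).
by rewrite !ler_pM ?mulr_ge0 ?powR_ge0.
Qed.

End pointwise.

(** * The Euclidean norm: triangle inequality and measurability *)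

Section euclidean_norm.
Context {R : realType} {n : nat}.
Implicit Types u v w : 'rV[R]_n.

Lemma enorm_ge0 u : 0 <= enorm u.
Proof. exact: sqrtr_ge0. Qed.

Lemma enorm_sqr u : enorm u ^+ 2 = \sum_(i < n) u ord0 i ^+ 2.
Proof. by rewrite sqr_sqrtr// sumr_ge0// => i _; exact: sqr_ge0. Qed.

Lemma coord_le_enorm u i : `|u ord0 i| <= enorm u.
Proof.
rewrite -sqrtr_sqr ler_wsqrtr// (bigD1 i)//= lerDl sumr_ge0// => j _.
exact: sqr_ge0.
Qed.

Lemma enorm0 : enorm (0 : 'rV[R]_n) = 0.
Proof.
by apply/eqP; rewrite -[_ == 0](sqrf_eq0 (enorm 0)) enorm_sqr big1// => i _; rewrite mxE expr0n.
Qed.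

Lemma enorm_eq0 u : enorm u = 0 -> u = 0.
Proof.
move=> u0; apply/rowP => i; rewrite mxE; apply/eqP.
by rewrite -normr_le0 (le_trans (coord_le_enorm u i))// u0.
Qed.

Lemma enormN u : enorm (- u) = enorm u.
Proof. by rewrite /enorm; congr Num.sqrt; apply: eq_bigr => i _; rewrite mxE sqrrN. Qed.

Lemma enormB u v : enorm (u - v) = enorm (v - u).
Proof. by rewrite -enormN opprB. Qed.

Lemma enorm_gt0 u v : u != v -> 0 < enorm (u - v).
Proof.
rewrite lt_neqAle enorm_ge0 andbT; apply: contraNneq => /esym/enorm_eq0/eqP.
by rewrite subr_eq0.
Qed.

Lemma enormD u v : enorm (u + v) <= enorm u + enorm v.
Proof.
have [/eqP u0|u0] := boolP (enorm u == 0).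
  by rewrite (enorm_eq0 _ u0) add0r enorm0 add0r.
have [/eqP v0|v0] := boolP (enorm v == 0).
  by rewrite (enorm_eq0 _ v0) addr0 enorm0 addr0.
have U0 : 0 < enorm u by rewrite lt_neqAle eq_sym u0 enorm_ge0.
have V0 : 0 < enorm v by rewrite lt_neqAle eq_sym v0 enorm_ge0.
set U := enorm u in u0 U0 *; set V := enorm v in v0 V0 *.
rewrite -(@ler_pXn2r _ 2)// ?nnegrE ?enorm_ge0 ?addr_ge0 ?(ltW U0) ?(ltW V0)//.
rewrite enorm_sqr.
(* Coordinatewise 2 a b <= (V / U) a^2 + (U / V) b^2; these weights make the sum over i exactly (U +
   V)^2. *)
apply: (@le_trans _ _ (\sum_(i < n) ((1 + V / U) * u ord0 i ^+ 2 + (1 + U / V) * v ord0 i ^+ 2))).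
  apply: ler_sum => i _; rewrite mxE.
  have := sqr_ge0 (V * u ord0 i - U * v ord0 i); set a := u ord0 i; set b := v ord0 i.
  have -> : (V * a - U * b) ^+ 2 = U * V * ((V / U) * a ^+ 2 + (U / V) * b ^+ 2 - 2 * a * b).
    by field; rewrite u0 v0.
  by rewrite pmulr_rge0 ?mulr_gt0//; nra.
rewrite big_split/= -!mulr_sumr -!enorm_sqr -/U -/V le_eqVlt; apply/orP; left; apply/eqP.
by field; rewrite u0 v0.
Qed.

Lemma enorm_triangle w u v : enorm (u - v) <= enorm (u - w) + enorm (v - w).
Proof. by rewrite (enormB v) (le_trans _ (enormD _ _))// addrA subrK. Qed.

Lemma dist_enorm w u v : `|enorm (u - w) - enorm (v - w)| <= enorm (u - v).
Proof.
rewrite ler_norml; have := enorm_triangle v u w; have := enorm_triangle u v w.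
rewrite (enormB v u) (enormB w u) (enormB w v).
by move=> ? ?; apply/andP; split; lra.
Qed.

Lemma measurable_enormB d (S : measurableType d) (f g : S -> 'rV[R]_n) :
  measurable_fun setT f -> measurable_fun setT g ->
  measurable_fun setT (fun s => enorm (f s - g s)).
Proof.
move=> mf mg; rewrite (_ : (fun _ => _) =
    (fun s => (\sum_(i < n) (f s - g s) ord0 i ^+ 2) `^ 2^-1)); last first.
  apply/funext => s; rewrite powR12_sqrt// sumr_ge0// => i _; exact: sqr_ge0.
apply: (measurableT_comp (measurable_powR (2^-1)) _).
apply: measurable_sum => i; apply: measurable_funX.
rewrite (_ : (fun _ => _) = (fun s => f s ord0 i) \- (fun s => g s ord0 i)); last first.
  by apply/funext => s /=; rewrite !mxE.
by apply: measurable_funB; apply: (measurableT_comp (measurable_coord i)).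
Qed.

End euclidean_norm.

(** * Radial integrals by dyadic decomposition *)

Section radial.
Context {R : realType} {n : nat}.
Notation mu := (@lebesgue_measure_rV R n).

(** Cubes replace balls because the measure is known on boxes; for upper bounds it is enough that a
    cube contains the ball of the same radius. *)
Definition cube (w : 'rV[R]_n) (r : R) : set 'rV[R]_n :=
  [set v | forall i, `[w ord0 i - r, w ord0 i + r]%classic (v ord0 i)].

Lemma measurable_cube w r : measurable (cube w r).
Proof. exact: (@measurable_rV_box _ R n
  (fun i => `[w ord0 i - r, w ord0 i + r]%classic) (fun i => measurable_itv _)).
Qed.

Lemma lebesgue_measure_cube w r : 0 < r -> mu (cube w r) = ((2 * r) ^+ n)%:E.
Proof.
move=> r0; rewrite [LHS](@lebesgue_measure_rV_box R n
  (fun i => `[w ord0 i - r, w ord0 i + r]%classic) (fun i => measurable_itv _)).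
rewrite (eq_bigr (fun=> (2 * r)%:E)); last first.
  move=> i _; rewrite lebesgue_measure_itv/= lte_fin ifT; last by lra.
  by rewrite -EFinB; congr EFin; ring.
by rewrite prodEFin prodr_const card_ord.
Qed.

Lemma enorm_cube (w v : 'rV[R]_n) r : enorm (v - w) <= r -> cube w r v.
Proof.
move=> vw i /=; rewrite in_itv/=; have := le_trans (coord_le_enorm (v - w) i) vw.
by rewrite !mxE ler_norml => /andP[? ?]; apply/andP; split; lra.
Qed.

Lemma integral_cube w r c : 0 < r -> 0 <= c ->
  (\int[mu]_x (c * \1_(cube w r) x)%:E = (c * (2 * r) ^+ n)%:E)%E.
Proof.
move=> r0 c0; have mc := measurable_cube w r.
under eq_integral do rewrite EFinM.
rewrite ge0_integralZl_EFin//; last exact/measurable_EFinP/measurable_indic.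
by rewrite integral_indic// setIT EFinM; congr (_ * _)%E; exact: lebesgue_measure_cube.
Qed.

(** k + 1 is the least m with t < 2^m; this m is not 0 because 1 <= t. *)
Lemma dyadic_scale (t : R) : 1 <= t ->
  exists k : nat, 2 `^ k%:R <= t < 2 `^ (k%:R + 1).
Proof.
move=> t1; have ex : exists m : nat, t < 2 ^+ m.
  exists (Num.bound t); rewrite (lt_trans (archi_boundP _))// ?(le_trans _ t1)//.
  by rewrite -natrX ltr_nat ltn_expl.
have [m tm mmin] := ex_minnP ex.
case: m tm mmin => [|k] tk mink; first by move: tk; rewrite expr0 ltNge t1.
exists k; rewrite natr1 !powR_mulrn// tk andbT leNgt; apply/negP => /mink.
by rewrite ltnn.
Qed.

Lemma nneseries_geometric_le (a g : R) : 0 <= a -> 0 <= g < 1 ->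
  (\sum_(0 <= k <oo) (a * g ^+ k)%:E <= (a / (1 - g))%:E)%E.
Proof.
move=> a0 /andP[g0 g1]; apply: lime_le.
  by apply: is_cvg_nneseries => k _ _; rewrite lee_fin mulr_ge0 ?exprn_ge0.
apply: nearW => m; rewrite sumEFin lee_fin -mulr_sumr ler_wpM2l//.
rewrite big_mkord.
have e : \sum_(i < m) g ^+ i = (1 - g ^+ m) / (1 - g).
  by rewrite -opprB subrX1 -mulNr opprB mulrC mulKf// gt_eqF// subr_gt0.
rewrite e ler_piMl ?invr_ge0 ?subr_ge0 ?(ltW g1)//.
by rewrite lerBlDr lerDl exprn_ge0.
Qed.

(* Dyadic decomposition around [w]: on the k-th shell inside (outside) the ball of radius r the
   integrand is comparable to its value at distance r 2^-k (r 2^k). *)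
Lemma radial_integral_le (p q : R) : p < n%:R -> n%:R < p + q ->
  exists2 C : R, 0 < C & forall (w : 'rV[R]_n) (r : R), 0 < r ->
   (\int[mu]_x (enorm (x - w) `^ (- p) * Num.max r (enorm (x - w)) `^ (- q))%:E <=
    (C * r `^ (n%:R - p - q))%:E)%E.
Proof.
move=> pn npq; pose g1 : R := 2 `^ (p - n%:R); pose g2 : R := 2 `^ (n%:R - p - q).
have two0 : 0 < 2 :> R by [].
have ln2 : 0 < ln 2 :> R by rewrite ln_gt0// ltr1n.
have g10 : 0 <= g1 < 1.
  by rewrite powR_ge0/= /g1 gt0_powRE// expR_lt1 pmulr_llt0// subr_lt0.
have g20 : 0 <= g2 < 1.
  by rewrite powR_ge0/= /g2 gt0_powRE// expR_lt1 pmulr_llt0//; lra.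
(* The coefficient [c1 k] times the volume of the cube of half-side [r1 k] is A1 r^(n-p-q) g1^k, and
   similarly for [c2], [r2], [A2], [g2]. Both ratios are below 1 because p < n < p + q. *)
pose A1 : R := 2 `^ `|p| * 2 `^ n%:R; pose A2 : R := 4 `^ n%:R.
exists (A1 / (1 - g1) + A2 / (1 - g2)).
  by rewrite addr_gt0// divr_gt0 ?mulr_gt0 ?powR_gt0// subr_gt0;
    [case/andP: g10|case/andP: g20].
move=> w r r0.
(* The exponent p may be negative, for instance in the outer integration when n = 1 and s1 + s2 > 1;
   the factor 2^|p| covers both signs. *)
pose c1 (k : nat) := 2 `^ `|p| * (r * 2 `^ (- k%:R)) `^ (- p) * r `^ (- q).
pose c2 (k : nat) := (r * 2 `^ k%:R) `^ (- (p + q)).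
pose r1 (k : nat) : R := r * 2 `^ (- k%:R).
pose r2 (k : nat) : R := r * 2 `^ (k%:R + 1).
have c10 k : 0 <= c1 k by rewrite !mulr_ge0 ?powR_ge0.
have c20 k : 0 <= c2 k by rewrite powR_ge0.
have r10 k : 0 < r1 k by rewrite mulr_gt0 ?powR_gt0.
have r20 k : 0 < r2 k by rewrite mulr_gt0 ?powR_gt0.
pose T1 k x := (c1 k * \1_(cube w (r1 k)) x)%:E.
pose T2 k x := (c2 k * \1_(cube w (r2 k)) x)%:E.
have T10 k x : (0 <= T1 k x)%E by rewrite lee_fin mulr_ge0.
have T20 k x : (0 <= T2 k x)%E by rewrite lee_fin mulr_ge0.
have mT1 k : measurable_fun setT (T1 k).
  apply/measurable_EFinP; apply: measurable_funM => //.
  by apply: measurable_indic; exact: measurable_cube.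
have mT2 k : measurable_fun setT (T2 k).
  apply/measurable_EFinP; apply: measurable_funM => //.
  by apply: measurable_indic; exact: measurable_cube.
(* A single term of the series dominates the integrand at each point. The cubes overlap, which is
   harmless for an upper bound. *)
have sum_ge k x : (T1 k x + T2 k x <= \sum_(0 <= j <oo) (T1 j x + T2 j x))%E.
  apply: le_trans (nneseries_lim_ge k.+1 _); last by move=> ? _ _; rewrite adde_ge0.
  by rewrite big_nat_recr//= leeDr// sume_ge0// => ? _; rewrite adde_ge0.
have me : measurable_fun setT (fun x : 'rV[R]_n => enorm (x - w)).
  exact: measurable_enormB.
apply: (@le_trans _ _ (\int[mu]_x \sum_(0 <= j <oo) (T1 j x + T2 j x))%E).
  apply: ge0_le_integral => //.
  - by move=> x _; rewrite lee_fin mulr_ge0 ?powR_ge0.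
  - apply/measurable_EFinP; apply: measurable_funM.
      exact: (measurableT_comp (measurable_powR _)).
    apply: (measurableT_comp (measurable_powR _)).
    exact: (measurable_maxr (f := cst r)).
  - by apply: ge0_emeasurable_sum => // k *; [rewrite adde_ge0|exact: emeasurable_funD].
  move=> x _; set t := enorm (x - w).
  have t0 : 0 <= t := enorm_ge0 _.
  (* At the centre the power with exponent -p takes its default value, 1 if p = 0 and 0 otherwise;
     the inner term of index 0 dominates it. *)
  have [tz|tn0] := eqVneq t 0.
    apply: le_trans (sum_ge 0%N x); apply: le_trans (leeDl _ (T20 _ _)).
    rewrite /T1 lee_fin indicE mem_set; last by apply: enorm_cube; rewrite -/t tz ltW.
    rewrite /c1 mulr1 tz (max_idPl (ltW r0)) oppr0 powRr0 mulr1 ler_wpM2r ?powR_ge0//.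
    have [->|pn0] := eqVneq p 0; first by rewrite normr0 oppr0 !powRr0 mulr1.
    by rewrite powR0 ?oppr_eq0// mulr_ge0 ?powR_ge0.
  have {tn0}t0 : 0 < t by rewrite lt_neqAle eq_sym tn0.
  have [rt|tr] := leP r t.
    have [k /andP[k1 k2]] : exists k : nat, 2 `^ k%:R <= t / r < 2 `^ (k%:R + 1).
      by apply: dyadic_scale; rewrite ler_pdivlMr// mul1r.
    rewrite ler_pdivlMr// mulrC in k1; rewrite ltr_pdivrMr// mulrC in k2.
    apply: le_trans (sum_ge k x); apply: le_trans (leeDr _ (T10 _ _)).
    rewrite /T2 lee_fin indicE mem_set ?mulr1; last by apply: enorm_cube; exact: ltW.
    have -> : t `^ (- p) * t `^ (- q) = t `^ (- (p + q)).
      by rewrite !gt0_powRE// -expRD; congr expR; ring.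
    apply: powRN_anti => //; first by rewrite mulr_gt0 ?powR_gt0.
    by rewrite (le_trans _ (ltW npq)).
  have [k /andP[k1 k2]] : exists k : nat, 2 `^ k%:R <= r / t < 2 `^ (k%:R + 1).
    by apply: dyadic_scale; rewrite ler_pdivlMr// mul1r ltW.
  have r1k : t <= r1 k.
    by rewrite /r1 powRN ler_pdivlMr ?powR_gt0// mulrC -ler_pdivlMr.
  have r1k' : r1 k <= 2 * t.
    have e2 : 2 `^ (k%:R + 1) = 2 `^ k%:R * 2 :> R.
      by rewrite powRD ?powRr1// pnatr_eq0 implybT.
    rewrite /r1 powRN ler_pdivrMr ?powR_gt0//.
    by move: k2; rewrite e2 ltr_pdivrMr// => /ltW; rewrite -mulrA mulrC.
  apply: le_trans (sum_ge k x); apply: le_trans (leeDl _ (T20 _ _)).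
  rewrite /T1 lee_fin indicE mem_set ?mulr1; last exact: enorm_cube.
  rewrite /c1 -/(r1 k) ler_wpM2r ?powR_ge0//.
  have [p0|p0] := leP 0 p.
    by rewrite ger0_norm//; apply: powRN_le.
  have np0 : 0 <= - p by rewrite oppr_ge0 ltW.
  apply: (@le_trans _ _ (r1 k `^ (- p))).
    by apply: ge0_ler_powR; rewrite ?nnegrE// ltW.
  rewrite ler_peMl ?powR_ge0// -[leLHS](powRr0 2) ler_powR ?ler1n//.
rewrite integral_nneseries//; last 2 first.
- by move=> k; exact: emeasurable_funD.
- by move=> k x _; rewrite adde_ge0.
have e k : (\int[mu]_x (T1 k x + T2 k x) =
   (A1 * r `^ (n%:R - p - q) * g1 ^+ k)%:E + (A2 * r `^ (n%:R - p - q) * g2 ^+ k)%:E)%E.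
  rewrite ge0_integralD// !integral_cube//.
  have r2k0 j : 0 < 2 * r1 j by rewrite mulr_gt0.
  have r2k0' j : 0 < 2 * r2 j by rewrite mulr_gt0.
  congr (_%:E + _%:E)%E.
    rewrite -!powR_mulrn ?powR_ge0 ?(ltW (r2k0 _))// /c1 /r1 /A1 /g1.
    rewrite !gt0_powRE ?mulr_gt0 ?expR_gt0// !lnM ?posrE ?mulr_gt0 ?expR_gt0// !expRK.
    by rewrite -!expRD; congr expR; ring.
  rewrite -!powR_mulrn ?powR_ge0 ?(ltW (r2k0' _))// /c2 /r2 /A2 /g2.
  have -> : 4 = 2 * 2 :> R by ring.
  rewrite !gt0_powRE ?mulr_gt0 ?expR_gt0// !lnM ?posrE ?mulr_gt0 ?expR_gt0// !expRK.
  by rewrite -!expRD; congr expR; ring.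
under eq_eseriesr do rewrite e.
have rr := powR_ge0 r (n%:R - p - q).
rewrite nneseriesD; last 2 first.
- by move=> k _ _; rewrite lee_fin !mulr_ge0 ?powR_ge0// exprn_ge0 ?powR_ge0.
- by move=> k _ _; rewrite lee_fin !mulr_ge0 ?powR_ge0// exprn_ge0 ?powR_ge0.
rewrite mulrDl EFinD; apply: leeD.
  rewrite [A1 / _ * _]mulrAC; apply: nneseries_geometric_le => //.
  by rewrite !mulr_ge0 ?powR_ge0.
rewrite [A2 / _ * _]mulrAC; apply: nneseries_geometric_le => //.
by rewrite !mulr_ge0 ?powR_ge0.
Qed.

End radial.

(** * Measurability of the dominating kernels *)

Section measurable_kernels.
Context {R : realType} d (S : measurableType d).
Implicit Types f g : S -> R.

Lemma measurable_powR_comp f (p : R) : measurable_fun setT f ->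
  measurable_fun setT (fun s => f s `^ p).
Proof. exact: (measurableT_comp (measurable_powR p)). Qed.

(** The inverse is f (f^2)^-1, also where f vanishes; squaring makes the base of the real power
    nonnegative. *)
Lemma measurable_inv f : measurable_fun setT f -> measurable_fun setT (fun s => (f s)^-1).
Proof.
move=> mf; rewrite (_ : (fun _ => _) = (fun s => f s * (f s ^+ 2) `^ (-1))).
  by apply: measurable_funM => //; apply: measurable_powR_comp; exact: measurable_funX.
apply/funext => s; rewrite powR_inv1 ?sqr_ge0//.
have [->|f0] := eqVneq (f s) 0; first by rewrite invr0 mul0r.
by field.
Qed.

Lemma measurable_pker (p1 q1 p2 q2 e : R) f g : measurable_fun setT f -> measurable_fun setT g ->
  measurable_fun setT (fun s => pker p1 q1 p2 q2 e (f s) (g s)).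
Proof.
move=> mf mg.
apply: measurable_funM; apply: measurable_funM; apply: measurable_powR_comp => //.
  exact: measurable_maxr.
exact: measurable_maxr.
Qed.

Lemma measurable_hker (c t1 t2 b1 b2 : R) f f1 g1 f2 g2 : measurable_fun setT f ->
  measurable_fun setT f1 -> measurable_fun setT g1 ->
  measurable_fun setT f2 -> measurable_fun setT g2 ->
  measurable_fun setT (fun s => hker c t1 t2 b1 b2 (f s) (f1 s) (g1 s) (f2 s) (g2 s)).
Proof.
move=> mf mf1 mg1 mf2 mg2; rewrite /hker.
repeat apply: measurable_funM; apply: measurable_powR_comp => //;
  (try apply: measurable_funM => //); (try apply: measurable_inv);
  by [exact: measurable_maxr|exact: measurable_minr].
Qed.

End measurable_kernels.

(** * Exchange of variables and null slabs for the product measure *)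

Section product_measure.
Local Open Scope ereal_scope.
Context {R : realType} {d} {T : measurableType d} (mu : {sigma_finite_measure set T -> \bar R}).

Lemma integral_prod_swap (f : T * T -> \bar R) : measurable_fun setT f -> (forall z, 0 <= f z) ->
  \int[mu \x mu]_z f (z.2, z.1) = \int[mu \x mu]_z f z.
Proof.
move=> mf f0; rewrite (fubini_tonelli2 f)// fubini_tonelli1//.
apply: measurableT_comp => //; exact: measurable_fun_pair.
Qed.

Lemma ae_prod1 (x : T) : measurable [set x] -> mu [set x] = 0 ->
  {ae (mu \x mu), forall z, z.1 <> x}.
Proof.
move=> mx x0; exists ([set x] `*` setT); split; first exact: measurableX.
  by rewrite product_measure1E// [X in X * _](_ : _ = 0) ?mul0e.
by move=> z /= /contrapT zx; split.
Qed.

Lemma ae_prod2 (x : T) : measurable [set x] -> mu [set x] = 0 ->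
  {ae (mu \x mu), forall z, z.2 <> x}.
Proof.
move=> mx x0; exists (setT `*` [set x]); split; first exact: measurableX.
  by rewrite product_measure1E// [X in _ * X](_ : _ = 0) ?mule0.
by move=> z /= /contrapT zx; split.
Qed.

End product_measure.

(** * Double integrals of the dominating kernels *)

Section double_integrals.
Context {R : realType} {n : nat}.
Notation mu := (@lebesgue_measure_rV R n).
Implicit Types w : 'rV[R]_n.

Lemma set1_box w : [set w] = [set v : 'rV[R]_n | forall i, [set w ord0 i] (v ord0 i)].
Proof.
by apply/seteqP; split => [v -> //|v /= vw]; apply/rowP.
Qed.

Lemma measurable_set1_rV w : measurable [set w].
Proof.
rewrite set1_box.
exact: (@measurable_rV_box _ R n (fun i => [set w ord0 i]) (fun i => measurable_set1 _)).
Qed.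

Lemma lebesgue_measure_set1_rV w : (0 < n)%N -> mu [set w] = 0%E.
Proof.
move=> n0; rewrite set1_box.
rewrite [LHS](@lebesgue_measure_rV_box R n (fun i => [set w ord0 i])
   (fun i => measurable_set1 _)).
by rewrite (bigD1 (Ordinal n0))//= lebesgue_measure_set1 mul0e.
Qed.

(** With r = |x - w|, the inner integral is radial about [ctr x] and gives a multiple of
    r^(n-p2-q2), so the outer one is radial about w with exponents p1 + p2 + q2 - n and q1. The
    inner centre may depend on x because it is x itself in one application and a fixed point in the
    other. *)
Lemma pker_integral_le (p1 q1 p2 q2 : R) : p1 != 0 -> p2 < n%:R -> n%:R < p2 + q2 ->
  p1 + p2 + q2 < 2 * n%:R -> 2 * n%:R < p1 + q1 + p2 + q2 ->
  exists2 C : R, 0 < C & forall w (ctr : 'rV[R]_n -> 'rV[R]_n) (d : R),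
   measurable_fun setT ctr -> 0 < d ->
   (\int[mu]_x \int[mu]_y (pker p1 q1 p2 q2 d (enorm (x - w)) (enorm (y - ctr x)))%:E <=
    (C * d `^ (2 * n%:R - p1 - q1 - p2 - q2))%:E)%E.
Proof.
move=> p10 p2n npq2 pn npq.
have [C1 C10 H1] := @radial_integral_le R n p2 q2 p2n npq2.
have a1 : p1 + p2 + q2 - n%:R < n%:R by lra.
have a2 : n%:R < p1 + p2 + q2 - n%:R + q1 by lra.
have [C2 C20 H2] := @radial_integral_le R n _ q1 a1 a2.
exists (C1 * C2); first exact: mulr_gt0.
move=> w ctr d mctr d0.
have mxy : measurable_fun setT (fun z : 'rV[R]_n * 'rV[R]_n => enorm (z.2 - ctr z.1)).
  apply: measurable_enormB => //.
  exact: (measurableT_comp mctr).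
have mx : measurable_fun setT (fun z : 'rV[R]_n * 'rV[R]_n => enorm (z.1 - w)).
  exact: measurable_enormB.
have mx1 : measurable_fun setT (fun x : 'rV[R]_n => enorm (x - w)).
  exact: measurable_enormB.
pose g x := enorm (x - w) `^ (- (p1 + p2 + q2 - n%:R)) * Num.max d (enorm (x - w)) `^ (- q1).
have mg : measurable_fun setT g.
  by apply: measurable_funM; apply: measurable_powR_comp => //; apply: measurable_maxr.
apply: (@le_trans _ _ (\int[mu]_x (C1 * g x)%:E)%E).
  apply: ge0_le_integral => //.
  - by move=> x _; apply: integral_ge0 => y _; rewrite lee_fin pker_ge0.
  - pose f (z : 'rV[R]_n * 'rV[R]_n) :=
      (pker p1 q1 p2 q2 d (enorm (z.1 - w)) (enorm (z.2 - ctr z.1)))%:E.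
    have mf : measurable_fun setT f by apply/measurable_EFinP; exact: measurable_pker.
    have f0 z : (0 <= f z)%E by rewrite lee_fin pker_ge0.
    exact: (measurable_fun_fubini_tonelli_F (m2 := mu) f mf f0).
  - by apply/measurable_EFinP; exact: measurable_funM.
  move=> x _; rewrite /pker.
  under eq_integral do rewrite EFinM.
  (* At x = w the radial bound does not apply, but p1 != 0 makes the factor r^-p1 equal to 0 by
     convention. *)
  have [r0|rn0] := eqVneq (enorm (x - w)) 0.
    rewrite integral0_eq ?lee_fin ?mulr_ge0 ?powR_ge0 ?(ltW C10)// => y _.
    by rewrite r0 powR0 ?oppr_eq0// mul0r mul0e.
  have r0 : 0 < enorm (x - w) by rewrite lt_neqAle eq_sym rn0 enorm_ge0.
  rewrite ge0_integralZl_EFin//; last 3 first.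
  - by move=> y _; rewrite lee_fin mulr_ge0 ?powR_ge0.
  - have my : measurable_fun setT (fun y : 'rV[R]_n => enorm (y - ctr x)) by exact: measurable_enormB.
    apply/measurable_EFinP; apply: measurable_funM; apply: measurable_powR_comp => //.
    exact: measurable_maxr.
  - by rewrite mulr_ge0 ?powR_ge0.
  apply: (le_trans (lee_wpmul2l _ (H1 (ctr x) _ r0))).
    by rewrite lee_fin mulr_ge0 ?powR_ge0.
  rewrite -EFinM lee_fin /g le_eqVlt; apply/orP; left; apply/eqP.
  have m0 : 0 < Num.max d (enorm (x - w)) by rewrite lt_max d0.
  have -> : enorm (x - w) `^ (- (p1 + p2 + q2 - n%:R)) =
    enorm (x - w) `^ (- p1) * enorm (x - w) `^ (n%:R - p2 - q2).
    by rewrite -powRD ?rn0 ?implybT//; congr (_ `^ _); ring.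
  ring.
under eq_integral do rewrite EFinM.
rewrite ge0_integralZl_EFin//; last 3 first.
- by move=> x _; rewrite lee_fin mulr_ge0 ?powR_ge0.
- exact/measurable_EFinP.
- exact: ltW.
rewrite -mulrA EFinM; apply: lee_wpmul2l; first by rewrite lee_fin ltW.
apply: (le_trans (H2 w d d0)).
by rewrite lee_fin le_eqVlt; apply/orP; left; apply/eqP; congr (_ * _ `^ _); ring.
Qed.

(* Dominates [hker_at] below where |z.1 - w1| is the smallest of the four distances;
   the first summand is to be integrated over z.2 first, the second over z.1 first. *)
Definition hpair (c t1 t2 b1 b2 d : R) w1 w2 (z : 'rV[R]_n * 'rV[R]_n) : R :=
  pker b1 (b2 + t2) (c - t1 - t2) t1 d (enorm (z.1 - w1)) (enorm (z.1 - z.2)) +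
  pker (b2 - n%:R) c b1 n%:R d (enorm (z.2 - w2)) (enorm (z.1 - w1)).

Lemma hpair_ge0 (c t1 t2 b1 b2 d : R) w1 w2 z : 0 <= hpair c t1 t2 b1 b2 d w1 w2 z.
Proof. by rewrite addr_ge0 ?pker_ge0. Qed.

Let measurable_fst_w w :
  measurable_fun setT (fun z : 'rV[R]_n * 'rV[R]_n => enorm (z.1 - w)).
Proof. exact: measurable_enormB. Qed.

Let measurable_snd_w w :
  measurable_fun setT (fun z : 'rV[R]_n * 'rV[R]_n => enorm (z.2 - w)).
Proof. exact: measurable_enormB. Qed.

Let measurable_fst_snd :
  measurable_fun setT (fun z : 'rV[R]_n * 'rV[R]_n => enorm (z.1 - z.2)).
Proof. exact: measurable_enormB. Qed.

Lemma measurable_hpair (c t1 t2 b1 b2 d : R) w1 w2 :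
  measurable_fun setT (hpair c t1 t2 b1 b2 d w1 w2).
Proof. by apply: measurable_funD; exact: measurable_pker. Qed.

(** Both summands satisfy the exponent conditions of [pker_integral_le]. In the first, the inner
    exponents are n - 2 e near the centre and n + s1 - e at infinity, whence 0 < e < s1, and the
    outer singularity has exponent n + B1 - e, whence B1 < e. In the second, the free exponent is n,
    and B1 < s1 and B2 < s2 are what matters. The total homogeneity is -(n + B1 + B2) in both. *)
Lemma hpair_integral_le (s1 s2 e B1 B2 : R) : (0 < n)%N ->
  0 < e -> e < s1 -> e < s2 -> s1 < 1 -> s2 < 1 ->
  0 <= B1 -> B1 < e -> 0 <= B2 -> B2 < e ->
  exists2 C : R, 0 < C & forall w1 w2 (d : R), 0 < d ->
   (\int[mu \x mu]_z (hpair (n%:R + s1 + s2) (s1 + e) (s2 + e)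
      (n%:R - s1 + B1) (n%:R - s2 + B2) d w1 w2 z)%:E <=
    (C * d `^ (- (n%:R + B1 + B2)))%:E)%E.
Proof.
move=> n0 e0 es1 es2 s11 s21 B10 B1e B20 B2e.
have n1 : 1 <= n%:R :> R by rewrite ler1n.
set c := _ + s2; set t1 := s1 + e; set t2 := s2 + e.
set b1 := _ + B1; set b2 := _ + B2.
have [||||| C1 C10 H1] := @pker_integral_le b1 (b2 + t2) (c - t1 - t2) t1.
- by rewrite gt_eqF// /b1; lra.
- by rewrite /c /t1 /t2; lra.
- by rewrite /c /t1 /t2; lra.
- by rewrite /b1 /c /t1 /t2; lra.
- by rewrite /b1 /b2 /c /t1 /t2; lra.
have [||||| C2 C20 H2] := @pker_integral_le (b2 - n%:R) c b1 n%:R.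
- by rewrite lt_eqF// /b2; lra.
- by rewrite /b1; lra.
- by rewrite /b1; lra.
- by rewrite /b1 /b2; lra.
- by rewrite /b1 /b2 /c; lra.
exists (C1 + C2); first exact: addr_gt0.
move=> w1 w2 d d0; rewrite /hpair; under eq_integral do rewrite EFinD.
rewrite ge0_integralD//; last 4 first.
- by move=> z _; rewrite lee_fin pker_ge0.
- by apply/measurable_EFinP; exact: measurable_pker.
- by move=> z _; rewrite lee_fin pker_ge0.
- by apply/measurable_EFinP; exact: measurable_pker.
rewrite mulrDl EFinD; apply: leeD.
  rewrite fubini_tonelli1//; last 2 first.
  - by apply/measurable_EFinP; exact: measurable_pker.
  - by move=> z; rewrite lee_fin pker_ge0.
  have := H1 w1 id d (@measurable_id _ _ _) d0.
  rewrite (_ : 2 * n%:R - b1 - (b2 + t2) - (c - t1 - t2) - t1 = - (n%:R + B1 + B2)); last first.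
    by rewrite /b1 /b2 /t1 /t2 /c; ring.
  apply: le_trans; rewrite le_eqVlt; apply/orP; left; apply/eqP.
  by apply: eq_integral => x _; apply: eq_integral => y _ /=; rewrite (enormB x y).
rewrite fubini_tonelli2//; last 2 first.
- by apply/measurable_EFinP; exact: measurable_pker.
- by move=> z; rewrite lee_fin pker_ge0.
have := H2 w2 (cst w1) d (measurable_cst _) d0.
rewrite (_ : 2 * n%:R - (b2 - n%:R) - c - b1 - n%:R = - (n%:R + B1 + B2))//.
by rewrite /b1 /b2 /c; ring.
Qed.

Definition hker_at (c t1 t2 b1 b2 : R) w1 w2 (z : 'rV[R]_n * 'rV[R]_n) : R :=
  hker c t1 t2 b1 b2 (enorm (z.1 - z.2)) (enorm (z.1 - w1)) (enorm (z.2 - w1))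
   (enorm (z.1 - w2)) (enorm (z.2 - w2)).

Lemma hker_at_ge0 (c t1 t2 b1 b2 : R) w1 w2 z : 0 <= hker_at c t1 t2 b1 b2 w1 w2 z.
Proof. exact: hker_ge0. Qed.

Lemma measurable_hker_at (c t1 t2 b1 b2 : R) w1 w2 :
  measurable_fun setT (hker_at c t1 t2 b1 b2 w1 w2).
Proof. exact: measurable_hker. Qed.

(** Exchanging x with y and w1 with w2 moves the smallest of the four distances to |x - w1|, where
    [hker_le] applies; the four possibilities give the four summands. *)
Lemma hker_at_le_hpair (c t1 t2 b1 b2 : R) w1 w2 z :
  0 < c -> 0 <= t1 -> 0 <= t2 -> 0 <= b1 -> 0 <= b2 ->
  w1 != w2 -> z.1 <> w1 -> z.1 <> w2 -> z.2 <> w1 -> z.2 <> w2 ->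
  hker_at c t1 t2 b1 b2 w1 w2 z <=
    2 `^ t1 * 2 `^ t2 * (4 `^ b2 + 3 `^ c) *
     (hpair c t1 t2 b1 b2 (enorm (w1 - w2)) w1 w2 z +
      hpair c t1 t2 b1 b2 (enorm (w1 - w2)) w1 w2 (z.2, z.1)) +
    2 `^ t1 * 2 `^ t2 * (4 `^ b1 + 3 `^ c) *
     (hpair c t2 t1 b2 b1 (enorm (w1 - w2)) w2 w1 z +
      hpair c t2 t1 b2 b1 (enorm (w1 - w2)) w2 w1 (z.2, z.1)).
Proof.
move=> c0 t10 t20 b10 b20 w12.
case: z => x y /= /eqP xw1 /eqP xw2 /eqP yw1 /eqP yw2.
set K1 := 2 `^ t1 * _ * _; set K2 := 2 `^ t1 * _ * _.
have K10 : 0 <= K1 by rewrite !mulr_ge0 ?addr_ge0 ?powR_ge0.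
have K20 : 0 <= K2 by rewrite !mulr_ge0 ?addr_ge0 ?powR_ge0.
have d0 := enorm_gt0 _ _ w12; set d := enorm (w1 - w2) in d0 *.
set A := hpair _ _ _ _ _ _ _ _ _; set A' := hpair _ _ _ _ _ _ _ _ _.
set B := hpair _ _ _ _ _ _ _ _ _; set B' := hpair _ _ _ _ _ _ _ _ _.
have A0 : 0 <= A := hpair_ge0 _ _ _ _ _ _ _ _ _.
have A'0 : 0 <= A' := hpair_ge0 _ _ _ _ _ _ _ _ _.
have B0 : 0 <= B := hpair_ge0 _ _ _ _ _ _ _ _ _.
have B'0 : 0 <= B' := hpair_ge0 _ _ _ _ _ _ _ _ _.
have aux (a b X Y Z T : R) : 0 <= a -> 0 <= b -> 0 <= X -> 0 <= Y -> 0 <= Z -> 0 <= T ->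
    [/\ a * X <= a * (X + Y) + b * (Z + T), a * Y <= a * (X + Y) + b * (Z + T),
     b * Z <= a * (X + Y) + b * (Z + T) & b * T <= a * (X + Y) + b * (Z + T)].
  move=> a0 b0 X0 Y0 Z0 T0; have := mulr_ge0 a0 X0; have := mulr_ge0 a0 Y0.
  by have := mulr_ge0 b0 Z0; have := mulr_ge0 b0 T0; split; lra.
have [leA leA' leB leB'] := aux K1 K2 A A' B B' K10 K20 A0 A'0 B0 B'0.
suff [H|[H|[H|H]]] : hker_at c t1 t2 b1 b2 w1 w2 (x, y) <= K1 * A \/
  hker_at c t1 t2 b1 b2 w1 w2 (x, y) <= K1 * A' \/
  hker_at c t1 t2 b1 b2 w1 w2 (x, y) <= K2 * B \/
  hker_at c t1 t2 b1 b2 w1 w2 (x, y) <= K2 * B'.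
- exact: le_trans leA.
- exact: le_trans leA'.
- exact: le_trans leB.
- exact: le_trans leB'.
move: {leA leA' leB leB'}A0.
rewrite /A /A' /B /B' /hker_at /hpair /= => _ {A A' B B' A'0 B0 B'0}.
rewrite (enormB y x).
(* On the diagonal the kernel is 0, since 0 to the nonzero power -c is 0 by convention. *)
have [->|xy] := eqVneq x y.
  left; rewrite subrr enorm0 /hker powR0 ?oppr_eq0 ?gt_eqF// !mul0r.
  by apply: mulr_ge0 => //; apply: addr_ge0; exact: pker_ge0.
have := enorm_gt0 _ _ xy; have := enorm_gt0 _ _ xw1; have := enorm_gt0 _ _ xw2.
have := enorm_gt0 _ _ yw1; have := enorm_gt0 _ _ yw2.
have := enorm_triangle w1 x y; have := enorm_triangle w2 x y.
have := dist_enorm w1 x y; have := dist_enorm w2 x y.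
have := enorm_triangle x w1 w2; have := enorm_triangle y w1 w2.
rewrite -/d (enormB w1 x) (enormB w2 x) (enormB w1 y) (enormB w2 y) !ler_norml.
set u1 := enorm (x - w1); set v1 := enorm (y - w1).
set u2 := enorm (x - w2); set v2 := enorm (y - w2); set rho := enorm (x - y).
move=> ? ? /andP[? ?] /andP[? ?] ? ? ? ? ? ? ?.
clearbody u1 v1 u2 v2 rho d; clear aux x y xw1 xw2 yw1 yw2 xy w12.
have : [\/ [/\ u1 <= v1, u1 <= u2 & u1 <= v2], [/\ v1 <= u1, v1 <= v2 & v1 <= u2],
   [/\ u2 <= v2, u2 <= u1 & u2 <= v1] | [/\ v2 <= u2, v2 <= v1 & v2 <= u1]].
  case: (leP u1 v1) => ?; case: (leP u2 v2) => ?.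
  - by case: (leP u1 u2) => ?; [apply: Or41|apply: Or43]; split; lra.
  - by case: (leP u1 v2) => ?; [apply: Or41|apply: Or44]; split; lra.
  - by case: (leP v1 u2) => ?; [apply: Or42|apply: Or43]; split; lra.
  - by case: (leP v1 v2) => ?; [apply: Or42|apply: Or44]; split; lra.
case=> -[? ? ?].
- left; apply: hker_le => //; lra.
- right; left; rewrite hkerCxy; apply: hker_le => //; lra.
- right; right; left; rewrite hkerC12 /K2 (mulrC (2 `^ t1)); apply: hker_le => //; lra.
- right; right; right; rewrite hkerC12 hkerCxy /K2 (mulrC (2 `^ t1)); apply: hker_le => //; lra.
Qed.

(** The pointwise bound holds off the null set where x or y is one of the centres. Exchanging x and
    y preserves the integral, so each of the two pairs of summands contributes twice an [hpair]
    integral. *)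
Lemma hker_integral_le (s1 s2 e B1 B2 : R) : (0 < n)%N ->
  0 < e -> e < s1 -> e < s2 -> s1 < 1 -> s2 < 1 ->
  0 <= B1 -> B1 < e -> 0 <= B2 -> B2 < e ->
  exists2 C : R, 0 < C & forall w1 w2, w1 != w2 ->
   (\int[mu \x mu]_z (hker_at (n%:R + s1 + s2) (s1 + e) (s2 + e)
      (n%:R - s1 + B1) (n%:R - s2 + B2) w1 w2 z)%:E <=
    (C * enorm (w1 - w2) `^ (- (n%:R + B1 + B2)))%:E)%E.
Proof.
move=> n0 e0 es1 es2 s11 s21 B10 B1e B20 B2e.
have n1 : 1 <= n%:R :> R by rewrite ler1n.
have [C1 C10 H1] := hpair_integral_le s1 s2 e B1 B2 n0 e0 es1 es2 s11 s21 B10 B1e B20 B2e.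
have [C2 C20 H2] := hpair_integral_le s2 s1 e B2 B1 n0 e0 es2 es1 s21 s11 B20 B2e B10 B1e.
rewrite (addrAC _ s2) (addrAC _ B2) in H2.
move: H1 H2; set c := _ + s2; set t1 := s1 + e; set t2 := s2 + e.
set b1 := _ + B1; set b2 := _ + B2 => H1 H2.
set K1 : R := 2 `^ t1 * 2 `^ t2 * (4 `^ b2 + 3 `^ c).
set K2 : R := 2 `^ t1 * 2 `^ t2 * (4 `^ b1 + 3 `^ c).
have K10 : 0 < K1 by rewrite !mulr_gt0 ?addr_gt0 ?powR_gt0.
have K20 : 0 < K2 by rewrite !mulr_gt0 ?addr_gt0 ?powR_gt0.
exists (2 * K1 * C1 + 2 * K2 * C2); first by rewrite addr_gt0 ?mulr_gt0.
move=> w1 w2 w12; have d0 := enorm_gt0 _ _ w12; set d := enorm (w1 - w2) in d0 *.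
pose swap (z : 'rV[R]_n * 'rV[R]_n) := (z.2, z.1).
have mswap : measurable_fun setT swap by exact: measurable_fun_pair.
have I (f : 'rV[R]_n * 'rV[R]_n -> R) (K B : R) : (forall z, 0 <= f z) -> measurable_fun setT f -> 0 < K ->
   (\int[mu \x mu]_z (f z)%:E <= B%:E)%E ->
   (\int[mu \x mu]_z (K * (f z + f (swap z)))%:E <= (2 * K * B)%:E)%E.
  move=> f0 mf K0 fB.
  under eq_integral do rewrite EFinM EFinD.
  have mfs : measurable_fun setT (fun z => f (swap z)) by exact: measurableT_comp.
  rewrite ge0_integralZl_EFin//; last 3 first.
  - by move=> z _; rewrite adde_ge0 ?lee_fin.
  - by apply: emeasurable_funD; exact/measurable_EFinP.
  - exact: ltW.
  rewrite ge0_integralD//; last 4 first.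
  - by move=> z _; rewrite lee_fin.
  - exact/measurable_EFinP.
  - by move=> z _; rewrite lee_fin.
  - exact/measurable_EFinP.
  rewrite (integral_prod_swap mu (fun z => (f z)%:E)); last 2 first.
  - exact/measurable_EFinP.
  - by move=> z; rewrite lee_fin.
  rewrite (_ : 2 * K * B = K * (B + B)); last by ring.
  by rewrite EFinM lee_wpmul2l ?lee_fin ?(ltW K0)// EFinD leeD.
pose F1 := hpair c t1 t2 b1 b2 d w1 w2.
pose F2 := hpair c t2 t1 b2 b1 d w2 w1.
have mF1 : measurable_fun setT F1 by exact: measurable_hpair.
have mF2 : measurable_fun setT F2 by exact: measurable_hpair.
have F10 z : 0 <= F1 z := hpair_ge0 _ _ _ _ _ _ _ _ _.
have F20 z : 0 <= F2 z := hpair_ge0 _ _ _ _ _ _ _ _ _.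
have mG (f : 'rV[R]_n * 'rV[R]_n -> R) K : measurable_fun setT f ->
    measurable_fun setT (fun z => (K * (f z + f (swap z)))%:E).
  move=> mf; apply/measurable_EFinP; apply: measurable_funM => //.
  by apply: measurable_funD => //; exact: measurableT_comp.
have G0 (f : 'rV[R]_n * 'rV[R]_n -> R) K z : (forall z, 0 <= f z) -> 0 < K ->
    (0 <= (K * (f z + f (swap z)))%:E)%E.
  by move=> f0 K0; rewrite lee_fin; apply: mulr_ge0; [exact: ltW|exact: addr_ge0].
apply: (@le_trans _ _ (\int[mu \x mu]_z
   ((K1 * (F1 z + F1 (swap z)))%:E + (K2 * (F2 z + F2 (swap z)))%:E))%E).
  apply: ae_ge0_le_integral => //.
  - by move=> z _; rewrite lee_fin hker_at_ge0.
  - by apply/measurable_EFinP; exact: measurable_hker_at.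
  - by move=> z _; apply: adde_ge0; exact: G0.
  - by apply: emeasurable_funD; exact: mG.
  have N1 w := ae_prod1 mu w (measurable_set1_rV w) (lebesgue_measure_set1_rV w n0).
  have N2 w := ae_prod2 mu w (measurable_set1_rV w) (lebesgue_measure_set1_rV w n0).
  near=> z => _; rewrite -EFinD lee_fin.
  have c0 : 0 < c by rewrite /c; lra.
  have t10 : 0 <= t1 by rewrite /t1; lra.
  have t20 : 0 <= t2 by rewrite /t2; lra.
  have b10 : 0 <= b1 by rewrite /b1; lra.
  have b20 : 0 <= b2 by rewrite /b2; lra.
  apply: hker_at_le_hpair => //.
  - by near: z; exact: N1.
  - by near: z; exact: N1.
  - by near: z; exact: N2.
  - by near: z; exact: N2.
rewrite ge0_integralD//; last 4 first.
- by move=> z _; exact: G0.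
- exact: mG.
- by move=> z _; exact: G0.
- exact: mG.
rewrite mulrDl EFinD -(mulrA _ C1) -(mulrA _ C2); apply: leeD.
  exact: (I F1 K1 _ F10 mF1 K10 (H1 _ _ _ d0)).
exact: (I F2 K2 _ F20 mF2 K20 (H2 _ _ _ d0)).
Unshelve. all: by end_near. Qed.

End double_integrals.

(** * Size and regularity of the singular kernel in L^1 *)

Section singular_kernel.
Context {R : realType} {n : nat}.
Notation mu := (@lebesgue_measure_rV R n).
Implicit Types w h : 'rV[R]_n.

(** This is the integrand of [kernelA] without the factor K; in the application c = n + 2 s. *)
Definition sker (c s1 s2 : R) w1 w2 (z : 'rV[R]_n * 'rV[R]_n) : R :=
  (enorm (z.1 - w1) `^ (s1 - n%:R) - enorm (z.2 - w1) `^ (s1 - n%:R)) *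
  (enorm (z.1 - w2) `^ (s2 - n%:R) - enorm (z.2 - w2) `^ (s2 - n%:R)) /
  enorm (z.1 - z.2) `^ c.

Lemma skerC (c s1 s2 : R) w1 w2 : sker c s1 s2 w1 w2 = sker c s2 s1 w2 w1.
Proof.
have aux (a b r : R) : a * b / r = b * a / r by rewrite (mulrC a).
by apply/funext => z; exact: aux.
Qed.

Lemma measurable_sker (c s1 s2 : R) w1 w2 : measurable_fun setT (sker c s1 s2 w1 w2).
Proof.
apply: measurable_funM; last first.
  by apply: measurable_inv; apply: measurable_powR_comp; exact: measurable_enormB.
by apply: measurable_funM; apply: measurable_funB; apply: measurable_powR_comp;
  exact: measurable_enormB.
Qed.

(** q^t' = q^(t'-t) q^t with q^(t'-t) <= 2. It serves for q = rho / M, which the triangle inequality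
    bounds by 2 and not by 1. *)
Lemma powR_le_double (q t t' : R) : 0 <= q <= 2 -> 0 < t' -> t <= t' <= t + 1 ->
  q `^ t' <= 2 * q `^ t.
Proof.
move=> /andP[q0 q2] t'0 /andP[tt' t't].
have [->|qn0] := eqVneq q 0; first by rewrite powR0 ?gt_eqF// mulr_ge0 ?powR_ge0.
rewrite -(subrK t t') powRD ?qn0 ?implybT// ler_wpM2r ?powR_ge0//.
apply: (@le_trans _ _ (2 `^ (t' - t))).
  by apply: ge0_ler_powR => //; rewrite ?subr_ge0 ?nnegrE.
rewrite -[leRHS](@powRr1 R 2)// ler_powR ?ler1n//.
by rewrite lerBlDr addrC.
Qed.

Lemma sker_le (c s1 s2 t1 t2 : R) w1 w2 z : 0 < s1 -> 0 < s2 ->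
  s1 <= n%:R -> s2 <= n%:R -> 0 <= t1 <= 1 -> 0 <= t2 <= 1 ->
  z.1 <> w1 -> z.1 <> w2 -> z.2 <> w1 -> z.2 <> w2 ->
  `|sker c s1 s2 w1 w2 z| <=
    n%:R * n%:R * hker_at c t1 t2 (n%:R - s1) (n%:R - s2) w1 w2 z.
Proof.
case: z => x y s10 s20 s1n s2n t1b t2b /= /eqP xw1 /eqP xw2 /eqP yw1 /eqP yw2.
have u10 := enorm_gt0 _ _ xw1; have u20 := enorm_gt0 _ _ xw2.
have v10 := enorm_gt0 _ _ yw1; have v20 := enorm_gt0 _ _ yw2.
have a10 : 0 <= n%:R - s1 by rewrite subr_ge0.
have a20 : 0 <= n%:R - s2 by rewrite subr_ge0.
have a1n : n%:R - s1 <= n%:R by rewrite lerBlDr lerDl ltW.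
have a2n : n%:R - s2 <= n%:R by rewrite lerBlDr lerDl ltW.
have h1 := dist_powRN_le n _ _ _ _ t1 u10 v10 (dist_enorm w1 x y) a10 a1n t1b.
have h2 := dist_powRN_le n _ _ _ _ t2 u20 v20 (dist_enorm w2 x y) a20 a2n t2b.
rewrite /sker /hker_at /hker /= -(opprB n%:R s1) -(opprB n%:R s2) !normrM.
have -> : `|(enorm (x - y) `^ c)^-1| = enorm (x - y) `^ (- c).
  by rewrite ger0_norm ?invr_ge0 ?powR_ge0// powRN.
apply: (le_trans (ler_wpM2r (powR_ge0 _ _) (ler_pM (normr_ge0 _) (normr_ge0 _) h1 h2))).
rewrite le_eqVlt; apply/orP; left; apply/eqP.
have aux (N Q1 m1 Q2 m2 X : R) :
    N * Q1 * m1 * (N * Q2 * m2) * X = N * N * (X * Q1 * Q2 * m1 * m2) by ring.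
exact: aux.
Qed.

(** Only the first factor depends on the moved centre. It is bounded by the second difference
    estimate, and the unchanged factor by the first difference estimate. *)
Lemma sker_diff_le (c s1 s2 t1 t2 al : R) w1 w2 h z : 0 < s1 -> 0 < s2 ->
  s1 <= n%:R -> s2 <= n%:R -> 0 <= t2 <= 1 ->
  0 <= al <= 1 -> 0 <= t1 -> t1 < 1 - al ->
  z.1 <> w1 -> z.1 <> w1 + h -> z.1 <> w2 -> z.2 <> w1 -> z.2 <> w1 + h -> z.2 <> w2 ->
  `|sker c s1 s2 (w1 + h) w2 z - sker c s1 s2 w1 w2 z| <=
    8 * n%:R * n%:R * enorm h `^ al *
     (hker_at c t1 t2 (n%:R - s1 + al) (n%:R - s2) w1 w2 z +
      hker_at c t1 t2 (n%:R - s1 + al) (n%:R - s2) (w1 + h) w2 z).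
Proof.
case: z => x y s10 s20 s1n s2n t2b alb t10 t1al /=.
move=> /eqP xw1 /eqP xh /eqP xw2 /eqP yw1 /eqP yh /eqP yw2.
have u10 := enorm_gt0 _ _ xw1; have u20 := enorm_gt0 _ _ xw2; have uh0 := enorm_gt0 _ _ xh.
have v10 := enorm_gt0 _ _ yw1; have v20 := enorm_gt0 _ _ yw2; have vh0 := enorm_gt0 _ _ yh.
have a10 : 0 <= n%:R - s1 by rewrite subr_ge0.
have a20 : 0 <= n%:R - s2 by rewrite subr_ge0.
have a1n : n%:R - s1 <= n%:R by rewrite lerBlDr lerDl ltW.
have a2n : n%:R - s2 <= n%:R by rewrite lerBlDr lerDl ltW.
have dh x' : `|enorm (x' - w1) - enorm (x' - (w1 + h))| <= enorm h.
  have := dist_enorm x' w1 (w1 + h).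
  by rewrite (enormB w1 x') (enormB _ x') (enormB w1) [w1 + h]addrC addrK.
have h1 := dist2_powRN_le n _ _ _ _ _ _ _ al u10 uh0 v10 vh0 (dh x) (dh y)
  (dist_enorm w1 x y) (dist_enorm (w1 + h) x y) (enorm_triangle w1 x y)
  (enorm_triangle (w1 + h) x y) a10 a1n alb.
have h2 := dist_powRN_le n _ _ _ _ t2 u20 v20 (dist_enorm w2 x y) a20 a2n t2b.
(* The exponent 1 - al is lowered to t1, so that the kernel takes the form integrated above; this
   doubles the constant 4 to 8. *)
have dbl w : 0 < enorm (x - w) ->
   (enorm (x - y) / Num.max (enorm (x - w)) (enorm (y - w))) `^ (1 - al) <=
    2 * (enorm (x - y) / Num.max (enorm (x - w)) (enorm (y - w))) `^ t1.
  move=> w0; have M0 : 0 < Num.max (enorm (x - w)) (enorm (y - w)) by rewrite lt_max w0.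
  case/andP: alb => al0 al1; apply: powR_le_double.
  - rewrite divr_ge0 ?enorm_ge0 ?(ltW M0)//= ler_pdivrMr// mulr_natl mulr2n.
    by rewrite (le_trans (enorm_triangle w x y))// lerD// le_max lexx ?orbT.
  - exact: le_lt_trans t1al.
  - by rewrite (ltW t1al)/= lerBlDr (addrC t1) -addrA lerDl addr_ge0.
rewrite /sker /hker_at /hker /= -(opprB n%:R s1) -(opprB n%:R s2) -!mulrBl !normrM.
have -> : `|(enorm (x - y) `^ c)^-1| = enorm (x - y) `^ (- c).
  by rewrite ger0_norm ?invr_ge0 ?powR_ge0// powRN.
have d1 := ler_wpM2r (powR_ge0 (Num.min (enorm (x - w1)) (enorm (y - w1))) (- (n%:R - s1 + al)))
  (dbl w1 u10).
have d2 := ler_wpM2r (powR_ge0 (Num.min (enorm (x - (w1 + h))) (enorm (y - (w1 + h))))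
  (- (n%:R - s1 + al))) (dbl (w1 + h) uh0).
have k0 : 0 <= 4 * n%:R * enorm h `^ al by rewrite !mulr_ge0 ?powR_ge0.
have {}h1 := le_trans h1 (ler_wpM2l k0 (lerD d1 d2)).
apply: (le_trans (ler_wpM2r (powR_ge0 _ _) (ler_pM (normr_ge0 _) (normr_ge0 _) h1 h2))).
rewrite le_eqVlt; apply/orP; left; apply/eqP.
have aux (N H Q1 m1 Q2 m2 Q3 m3 X : R) :
    4 * N * H * (2 * Q1 * m1 + 2 * Q2 * m2) * (N * Q3 * m3) * X =
    8 * N * N * H * (X * Q1 * Q3 * m1 * m3 + X * Q2 * Q3 * m2 * m3) by ring.
exact: aux.
Qed.

Let N1 w (n0 : (0 < n)%N) :=
  ae_prod1 mu w (measurable_set1_rV w) (lebesgue_measure_set1_rV w n0).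
Let N2 w (n0 : (0 < n)%N) :=
  ae_prod2 mu w (measurable_set1_rV w) (lebesgue_measure_set1_rV w n0).

Lemma sker_integral_le (s1 s2 : R) : (0 < n)%N -> 0 < s1 < 1 -> 0 < s2 < 1 ->
  exists2 C : R, 0 < C & forall w1 w2, w1 != w2 ->
   (\int[mu \x mu]_z (`|sker (n%:R + s1 + s2) s1 s2 w1 w2 z|)%:E <=
    (C * enorm (w1 - w2) `^ (- n%:R))%:E)%E.
Proof.
move=> n0 /andP[s10 s11] /andP[s20 s21].
have n1 : 1 <= n%:R :> R by rewrite ler1n.
(* Halving the minimum makes e < s1 and e < s2 strict and keeps the exponents s1 + e and s2 + e at
   most 1. *)
pose e := Num.min (Num.min s1 s2) (Num.min (1 - s1) (1 - s2)) / 2.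
have [e0 es1 es2 es1' es2'] : [/\ 0 < e, e < s1, e < s2, s1 + e <= 1 & s2 + e <= 1].
  have m0 : 0 < Num.min (Num.min s1 s2) (Num.min (1 - s1) (1 - s2)).
    by rewrite !lt_min s10 s20 !subr_gt0 s11 s21.
  have : e < 2 * e by rewrite /e; lra.
  have : 2 * e <= Num.min (Num.min s1 s2) (Num.min (1 - s1) (1 - s2)).
    by rewrite /e mulrC divfK.
  by rewrite !le_min -!andbA => /and4P[? ? ? ?] ?; split; lra.
have [C C0 H] := @hker_integral_le R n s1 s2 e 0 0 n0 e0 es1 es2 s11 s21
  (lexx _) e0 (lexx _) e0.
exists (n%:R * n%:R * C); first by rewrite !mulr_gt0 ?ltr0n.
move=> w1 w2 w12; have := H w1 w2 w12; rewrite !addr0 => {}H.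
set f := fun z => (hker_at (n%:R + s1 + s2) (s1 + e) (s2 + e) (n%:R - s1) (n%:R - s2) w1 w2 z)%:E.
rewrite -/f in H.
have mf : measurable_fun setT f by apply/measurable_EFinP; exact: measurable_hker_at.
have f0 z : (0 <= f z)%E by rewrite lee_fin hker_at_ge0.
apply: (@le_trans _ _ (\int[mu \x mu]_z ((n%:R * n%:R)%:E * f z))%E).
  apply: ae_ge0_le_integral => //.
  - by apply/measurable_EFinP; apply: measurableT_comp => //; exact: measurable_sker.
  - by move=> z _; apply: mule_ge0 => //; rewrite lee_fin mulr_ge0.
  - exact: measurable_funeM.
  near=> z => _; rewrite -EFinM lee_fin; apply: sker_le => //.
  - by rewrite (le_trans (ltW s11)).
  - by rewrite (le_trans (ltW s21)).
  - by rewrite es1' andbT addr_ge0// ltW.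
  - by rewrite es2' andbT addr_ge0// ltW.
  - by near: z; exact: N1.
  - by near: z; exact: N1.
  - by near: z; exact: N2.
  - by near: z; exact: N2.
rewrite ge0_integralZl_EFin ?mulr_ge0//.
by rewrite -(mulrA _ C) [leRHS]EFinM lee_wpmul2l// lee_fin mulr_ge0.
Unshelve. all: by end_near. Qed.

Lemma sker_diff_integral_le (s1 s2 al : R) : (0 < n)%N -> 0 < s1 < 1 -> 0 < s2 < 1 ->
  0 < al -> 4 * al <= Num.min (Num.min s1 s2) (Num.min (1 - s1) (1 - s2)) ->
  exists2 C : R, 0 < C & forall w1 w2 h, w1 != w2 -> enorm h <= 2^-1 * enorm (w1 - w2) ->
   (\int[mu \x mu]_z (`|sker (n%:R + s1 + s2) s1 s2 (w1 + h) w2 z -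
                        sker (n%:R + s1 + s2) s1 s2 w1 w2 z|)%:E <=
    (C * (enorm h `^ al * enorm (w1 - w2) `^ (- (n%:R + al))))%:E)%E.
Proof.
move=> n0 /andP[s10 s11] /andP[s20 s21] al0.
rewrite !le_min -!andbA => /and4P[als1 als2 als1' als2'].
have n1 : 1 <= n%:R :> R by rewrite ler1n.
(* Take e = 2 al, B1 = al, B2 = 0. Then B1 < e < s1, s2, and s1 + e < 1 - al because 4 al <= 1 -
   s1. *)
have [] := @hker_integral_le R n s1 s2 (2 * al) al 0 n0; try lra.
move=> C C0 H.
have n00 : 0 < n%:R :> R by rewrite ltr0n.
exists (8 * n%:R * n%:R * (C + C * 2 `^ (n%:R + al))).
  by rewrite !mulr_gt0// addr_gt0// mulr_gt0// powR_gt0.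
move=> w1 w2 h w12 hd.
have d0 := enorm_gt0 _ _ w12; set d := enorm (w1 - w2) in d0 hd *.
(* Since |h| <= d / 2, the moved centre stays at distance at least d / 2 from w2; this is the source
   of the factor 2^(n + al). *)
have dd' : d <= 2 * enorm (w1 + h - w2).
  have := enorm_triangle (w1 + h) w1 w2.
  rewrite (enormB w1 (w1 + h)) (addrAC w1 h) subrr add0r (enormB w2) -/d => tr.
  by move: hd tr; lra.
have w12' : w1 + h != w2.
  by apply/eqP => e; move: dd'; rewrite e subrr enorm0 mulr0 leNgt d0.
have := H w1 w2 w12; have := H (w1 + h) w2 w12'; rewrite !addr0 -/d => {}H' {}H.
have {}H' := le_trans H' (_ : _ <= (C * (2 `^ (n%:R + al) * d `^ (- (n%:R + al))))%:E)%E.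
have {}H' := H' ltac:(by rewrite lee_fin ler_wpM2l ?(ltW C0)//; apply: powRN_le => //; rewrite addr_ge0 ?(ltW al0)).
set f := fun z => (hker_at (n%:R + s1 + s2) (s1 + 2 * al) (s2 + 2 * al)
  (n%:R - s1 + al) (n%:R - s2) w1 w2 z)%:E.
set f' := fun z => (hker_at (n%:R + s1 + s2) (s1 + 2 * al) (s2 + 2 * al)
  (n%:R - s1 + al) (n%:R - s2) (w1 + h) w2 z)%:E.
rewrite -/f in H; rewrite -/f' in H'.
have mf : measurable_fun setT f by apply/measurable_EFinP; exact: measurable_hker_at.
have f0 z : (0 <= f z)%E by rewrite lee_fin hker_at_ge0.
have mf' : measurable_fun setT f' by apply/measurable_EFinP; exact: measurable_hker_at.
have f'0 z : (0 <= f' z)%E by rewrite lee_fin hker_at_ge0.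
set K := 8 * n%:R * n%:R * enorm h `^ al.
have K0 : 0 <= K by rewrite !mulr_ge0 ?powR_ge0.
have K0e : (0 <= K%:E)%E by rewrite lee_fin.
have ff0 z : (0 <= f z + f' z)%E := adde_ge0 (f0 z) (f'0 z).
have mff := emeasurable_funD mf mf'.
apply: (@le_trans _ _ (\int[mu \x mu]_z (K%:E * (f z + f' z)))%E).
  apply: ae_ge0_le_integral => //.
  - apply/measurable_EFinP; apply: measurableT_comp => //.
    by apply: measurable_funB; exact: measurable_sker.
  - by move=> z _; exact: (mule_ge0 K0e (ff0 z)).
  - exact: (measurable_funeM _ mff).
  have t2b : 0 <= s2 + 2 * al <= 1 by apply/andP; split; lra.
  have alb : 0 <= al <= 1 by apply/andP; split; lra.
  have t1b : 0 <= s1 + 2 * al by lra.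
  have t1al : s1 + 2 * al < 1 - al by lra.
  near=> z => _; rewrite lee_fin; apply: sker_diff_le => //.
  - by rewrite (le_trans (ltW s11)).
  - by rewrite (le_trans (ltW s21)).
  - by near: z; exact: N1.
  - by near: z; exact: N1.
  - by near: z; exact: N1.
  - by near: z; exact: N2.
  - by near: z; exact: N2.
  - by near: z; exact: N2.
clearbody f f'.
rewrite ge0_integralZl_EFin//.
rewrite ge0_integralD//.
apply: (@le_trans _ _ (K%:E * ((C * d `^ (- (n%:R + al)))%:E +
   (C * (2 `^ (n%:R + al) * d `^ (- (n%:R + al))))%:E))%E).
  by rewrite lee_wpmul2l ?lee_fin// leeD.
rewrite -EFinD -EFinM lee_fin le_eqVlt; apply/orP; left; apply/eqP.
by rewrite /K; ring.
Unshelve. all: by end_near. Qed.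

End singular_kernel.

(** * Pairing an essentially bounded function with an integrable one *)

Lemma ae_le_Lnormy d (T : measurableType d) (R : realType) (mu : {measure set T -> \bar R})
    (f : T -> R) :
  {ae mu, forall x, ((`|f x|)%:E <= 'N[mu]_+oo[EFin \o f])%E}.
Proof.
rewrite unlock; case: ifPn => [_|].
  by have := ess_sup_ge mu (abse \o (EFin \o f)); apply: filterS => x.
(* When the whole space has measure 0 the norm is 0 by convention, and the whole space serves as the
   exceptional set. *)
rewrite -leNgt measure_le0 => /eqP m0; exists setT; split => //.
Qed.

Section bounded_pairing.
Context {d} {T : measurableType d} {R : realType} {mu : {measure set T -> \bar R}}.
Variables (K : T -> R) (M : R).
Hypotheses (mK : measurable_fun setT K) (M0 : 0 <= M).
Hypothesis KM : {ae mu, forall x, `|K x| <= M}.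

Lemma integral_abs_mulr_le (G : T -> R) (b : R) : measurable_fun setT G ->
  (\int[mu]_x (`|G x|)%:E <= b%:E)%E ->
  (\int[mu]_x `|(K x * G x)%:E| <= (M * b)%:E)%E.
Proof.
move=> mG Gb.
have mG1 : measurable_fun setT (fun x => (`|G x|)%:E).
  by apply/measurable_EFinP; exact: measurableT_comp.
have mKG : measurable_fun setT (fun x => `|(K x * G x)%:E|%E).
  by apply: measurableT_comp => //; apply/measurable_EFinP; exact: measurable_funM.
apply: (@le_trans _ _ (\int[mu]_x (M%:E * (`|G x|)%:E))%E).
  apply: ae_ge0_le_integral => //.
  - by move=> x _; rewrite mule_ge0 ?lee_fin.
  - exact: measurable_funeM.
  apply: filterS KM => x KMx _; rewrite /= lee_fin normrM ler_wpM2r//.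
rewrite ge0_integralZl_EFin// [leRHS]EFinM lee_wpmul2l// lee_fin.
Qed.

Lemma integrable_mulr (G : T -> R) (b : R) : measurable_fun setT G ->
  (\int[mu]_x (`|G x|)%:E <= b%:E)%E ->
  mu.-integrable setT (EFin \o (fun x => K x * G x)).
Proof.
move=> mG Gb; apply/integrableP; split.
  by apply/measurable_EFinP; exact: measurable_funM.
exact: (le_lt_trans (integral_abs_mulr_le G b mG Gb) (ltry _)).
Qed.

Lemma abs_integral_mulr_le (G : T -> R) (b : R) : measurable_fun setT G ->
  (\int[mu]_x (`|G x|)%:E <= b%:E)%E ->
  (`|\int[mu]_x (K x * G x)%:E| <= (M * b)%:E)%E.
Proof.
move=> mG Gb; apply: le_trans (integral_abs_mulr_le G b mG Gb).
apply: le_abse_integral => //.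
by apply/measurable_EFinP; exact: measurable_funM.
Qed.

End bounded_pairing.

(** * Fubini and assembly of the three estimates *)

(** Fubini's theorem, with x integrated first. On the product space a difference of two values of
    the kernel becomes the integral of one difference of integrands, which is what the regularity
    estimate controls. *)
Lemma kernelA_prod (R : realType) (n : nat) (s s1 s2 : R)
    (K : 'rV[R]_n * 'rV[R]_n -> R) (w1 w2 : 'rV[R]_n) :
  (lebesgue_measure_rV n \x lebesgue_measure_rV n)%E.-integrable setT
    (EFin \o (fun z => K z * sker (n%:R + 2 * s) s1 s2 w1 w2 z)) ->
  kernelA s s1 s2 K w1 w2 = (\int[lebesgue_measure_rV n \x lebesgue_measure_rV n]_z
    (K z * sker (n%:R + 2 * s) s1 s2 w1 w2 z)%:E)%E.
Proof.
move=> iKG; rewrite -(integral21_prod_meas1 iKG) /kernelA.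
apply: eq_integral => y _; apply: eq_integral => x _.
have aux (k a b r : R) : k * a * b / r = k * (a * b / r) by rewrite !mulrA.
congr (_%:E); exact: aux.
Qed.

Theorem proposition1p2 (R : realType) (n : nat) (s s1 s2 : R) :
  (1 <= n)%N ->
  0 < s < 1 -> 0 < s1 < 1 -> 0 < s2 < 1 -> s1 + s2 = 2 * s ->
  exists alpha C : R, [/\ 0 < alpha, 0 < C &
    forall (K : 'rV[R]_n * 'rV[R]_n -> R) (z1 z2 : 'rV[R]_n),
      K \in Lfun (lebesgue_measure_rV n \x lebesgue_measure_rV n)%E +oo%E ->
      z1 != z2 ->
      let normK :=
        ('N[lebesgue_measure_rV n \x lebesgue_measure_rV n]_+oo[EFin \o K])%E in
      let A := kernelA s s1 s2 K in
      [/\ (`|A z1 z2| <= C%:E * (normK / (enorm (z1 - z2) ^+ n)%:E))%E,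
          forall h : 'rV[R]_n, enorm h <= 2^-1 * enorm (z1 - z2) ->
            (`|A (z1 + h)%R z2 - A z1 z2| <=
              C%:E * ((enorm h `^ alpha)%:E * normK
                      / (enorm (z1 - z2) `^ (n%:R + alpha))%:E))%E
        & forall h : 'rV[R]_n, enorm h <= 2^-1 * enorm (z1 - z2) ->
            (`|A z1 (z2 + h)%R - A z1 z2| <=
              C%:E * ((enorm h `^ alpha)%:E * normK
                      / (enorm (z1 - z2) `^ (n%:R + alpha))%:E))%E] ].
Proof.
move=> n0 s01 s1b s2b hs.
(* The minimum is symmetric in s1 and s2, so the same exponent serves for moving z1 and for moving
   z2. *)
pose al := Num.min (Num.min s1 s2) (Num.min (1 - s1) (1 - s2)) / 4.
have al0 : 0 < al.
  case/andP: s1b => s10 s11; case/andP: s2b => s20 s21.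
  by rewrite divr_gt0// !lt_min s10 s20 !subr_gt0 s11 s21.
have al4 : 4 * al <= Num.min (Num.min s1 s2) (Num.min (1 - s1) (1 - s2)).
  by rewrite /al mulrC divfK.
have al4' : 4 * al <= Num.min (Num.min s2 s1) (Num.min (1 - s2) (1 - s1)).
  by rewrite (minC s2) (minC (1 - s2)).
have [C1 C10 H1] := @sker_integral_le R n s1 s2 n0 s1b s2b.
have [C2 C20 H2] := @sker_diff_integral_le R n s1 s2 al n0 s1b s2b al0 al4.
have [C3 C30 H3] := @sker_diff_integral_le R n s2 s1 al n0 s2b s1b al0 al4'.
rewrite (addrAC _ s2) in H3.
have cE : n%:R + s1 + s2 = n%:R + 2 * s by rewrite -hs addrA.
rewrite cE in H1 H2 H3.
have Cge (X : R) : 0 <= X -> [/\ C1 * X <= (C1 + C2 + C3) * X, C2 * X <= (C1 + C2 + C3) * X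
    & C3 * X <= (C1 + C2 + C3) * X].
  by move=> X0; split; rewrite ler_wpM2r//; move: C10 C20 C30; lra.
exists al, (C1 + C2 + C3); split => //; first by rewrite !addr_gt0.
move=> K z1 z2 KL z12 normK A.
set c := n%:R + 2 * s in H1 H2 H3.
pose P := (lebesgue_measure_rV n \x lebesgue_measure_rV n)%E : {measure set _ -> \bar R}.
have mK : measurable_fun setT K by have := sub_Lfun_mfun KL; rewrite inE.
have normKfin : normK \is a fin_num.
  have := sub_Lfun_finLfun KL; rewrite inE /= /finite_norm => lt.
  by rewrite ge0_fin_numE// Lnorm_ge0.
pose M := fine normK.
have normKE : normK = M%:E by rewrite /M fineK.
have M0 : 0 <= M by rewrite /M fine_ge0// Lnorm_ge0.
have KM : {ae P, forall x, `|K x| <= M}.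
  have := ae_le_Lnormy _ _ _ P K; apply: filterS => x; rewrite -/normK normKE.
  by rewrite lee_fin.
have AE w1 w2 : w1 != w2 -> A w1 w2 = (\int[P]_z (K z * sker c s1 s2 w1 w2 z)%:E)%E.
  move=> w12; rewrite /A kernelA_prod//.
  exact: (integrable_mulr K M mK M0 KM _ _ (measurable_sker c s1 s2 w1 w2) (H1 w1 w2 w12)).
have d0 := enorm_gt0 _ _ z12; set d := enorm (z1 - z2) in d0 *.
have diffE (G G' : 'rV[R]_n * 'rV[R]_n -> R) b b' e :
    measurable_fun setT G -> measurable_fun setT G' ->
    (\int[P]_z (`|G z|)%:E <= b%:E)%E -> (\int[P]_z (`|G' z|)%:E <= b'%:E)%E ->
    (\int[P]_z (`|G z - G' z|)%:E <= e%:E)%E ->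
    (`|\int[P]_z (K z * G z)%:E - \int[P]_z (K z * G' z)%:E| <= (M * e)%:E)%E.
  move=> mG mG' Gb G'b' Ge.
  rewrite -integralB_EFin//; last 2 first.
  - exact: (integrable_mulr K M mK M0 KM _ _ mG Gb).
  - exact: (integrable_mulr K M mK M0 KM _ _ mG' G'b').
  under eq_integral do rewrite -EFinB -mulrBr.
  apply: (abs_integral_mulr_le K M mK M0 KM (fun z => G z - G' z) e) => //.
  exact: measurable_funB.
have fin (X Y : R) : 0 < Y -> (X%:E / Y%:E = (X / Y)%:E)%E.
  by move=> Y0; rewrite inver gt_eqF.
(* If w + h were w', then |h| = |w - w'| > 0, against |h| <= |w - w'| / 2. *)
have shift (w w' h : 'rV[R]_n) : w != w' -> enorm h <= 2^-1 * enorm (w - w') -> w + h != w'.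
  move=> ww' hw; have e0 := enorm_gt0 _ _ ww'.
  apply/eqP => e; move: hw; rewrite -e opprD addrA subrr add0r enormN.
  move: e0; rewrite -e opprD addrA subrr add0r enormN; lra.
have target h Ci : 0 <= Ci -> (forall X, 0 <= X -> Ci * X <= (C1 + C2 + C3) * X) ->
  ((M * (Ci * (enorm h `^ al * d `^ (- (n%:R + al)))))%:E <=
   (C1 + C2 + C3)%:E * ((enorm h `^ al)%:E * normK / (d `^ (n%:R + al))%:E))%E.
  move=> Ci0 CiX; rewrite normKE -EFinM fin ?powR_gt0// -EFinM lee_fin powRN.
  have -> (a b e r : R) : a * (b * (e * r)) = b * (e * a * r) by ring.
  by apply: CiX; rewrite divr_ge0 ?mulr_ge0 ?powR_ge0.
split.
- rewrite AE//.
  apply: (le_trans (abs_integral_mulr_le K M mK M0 KM _ _ (measurable_sker c s1 s2 z1 z2)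
    (H1 z1 z2 z12))).
  rewrite normKE fin ?exprn_gt0// -EFinM lee_fin -/d powRN powR_mulrn ?(ltW d0)//.
  rewrite mulrCA; have [X _ _] := Cge (M / d ^+ n) (divr_ge0 M0 (exprn_ge0 _ (ltW d0))).
  exact: X.
- move=> h hd; have z12' := shift _ _ _ z12 hd.
  rewrite !AE//.
  apply: (le_trans (diffE _ _ _ _ _ (measurable_sker _ _ _ _ _) (measurable_sker _ _ _ _ _)
    (H1 _ _ z12') (H1 _ _ z12) (H2 _ _ _ z12 hd))).
  by apply: target; [exact: ltW|move=> X X0; have [] := Cge X X0].
(* By [skerC], moving z2 amounts to moving the first centre of the kernel with s1 and s2 exchanged,
   so [H3] applies. *)
- move=> h; rewrite /d enormB => hd.
  have z21 : z2 != z1 by rewrite eq_sym.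
  have z21' := shift _ _ _ z21 hd.
  rewrite !AE//; last by rewrite eq_sym.
  rewrite (skerC c s1 s2 z1 (z2 + h)) (skerC c s1 s2 z1 z2).
  have H1' w1 w2 : w1 != w2 ->
    (\int[P]_z (`|sker c s2 s1 w2 w1 z|)%:E <= (C1 * enorm (w1 - w2) `^ (- n%:R))%:E)%E.
    by rewrite (skerC c s2 s1 w2 w1); exact: H1.
  have z12' : z1 != z2 + h by rewrite eq_sym.
  apply: (le_trans (diffE _ _ _ _ _ (measurable_sker _ _ _ _ _) (measurable_sker _ _ _ _ _)
    (H1' _ _ z12') (H1' _ _ z12) (H3 _ _ _ z21 hd))).
  rewrite (enormB z2) -/d.
  by apply: target; [exact: ltW|move=> X X0; have [] := Cge X X0].
Qed.
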